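(* Let $G=(V,E)$ be a connected, loopless and bridgeless graph with $n$ vertices and $m$ edges, and write its Tutte polynomial as $T(G;x,y)=\sum_{i,j} t_{i,j}x^iy^j$. Let $s(G)$ be the number of series classes of $G$, $s^*(G)$ the number of non-trivial series classes of $G$, and $\Theta(G)$ the number of $\Theta$ classes of $G$. Then \begin{enumerate} \item $t_{0,m-n+1}=1$; \item $t_{0,m-n}=n+s(G)-m-1$; \item $t_{0,m-n-1}=\binom{m-n+1}{2}-(m-n)\,s(G)+\binom{s(G)}{2}-\Theta(G)$; \item $t_{1,m-n}=s^*(G)$; \item $t_{1,m-n-1}=-s^*(G)(m-n)+\sum_{A} s(G-A)+\Theta(G)$, where the sum runs over all non-trivial series classes $A\subseteq E$ of $G$. \end{enumerate}
   Context: Graphs are finite and may have parallel edges. The Tutte polynomial is $T(G;x,y)=\sum_{A\subseteq E}(x-1)^{\rho(E)-\rho(A)}(y-1)^{\gamma(A)}$, where for $A\subseteq E$, $c(A)$ is the number of connected components of the spanning subgraph $(V,A)$, $\rho(A)=|V|-c(A)$ and $\gamma(A)=|A|-|V|+c(A)$. For $C\subseteq E$, $G-C$ denotes the graph obtained by deleting the edges of $C$ (keeping all vertices), and $G/C$ the graph obtained by contracting the edges of $C$. A series class of a connected bridgeless loopless graph $G$ is a maximal subset $C\subseteq E$ such that removing any two edges of $C$ increases the number of connected components; equivalently, $C$ is a series class iff $G-C$ has exactly $|C|$ connected components and $G-C$ is bridgeless. Series classes partition $E$. A series class is trivial if it has exactly one edge, non-trivial otherwise. If a bridgeless loopless graph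 is disconnected, its series classes are the union of the series classes of its connected components (so $s(G-A)$ is the total number of series classes over all components of $G-A$). For integers $k_1,k_2,k_3\ge1$, $\Theta_{k_1,k_2,k_3}$ is the graph consisting of two vertices $u,v$ joined by three internally disjoint paths of lengths $k_1,k_2,k_3$. A subset $C\subseteq E$ with $|C|=k_1+k_2+k_3$ is a $\Theta$ class of $G$ if $G-C$ is the disjoint union of exactly $k_1+k_2+k_3-1$ connected bridgeless graphs $G_1,\dots,G_{k_1+k_2+k_3-1}$ and the graph obtained from $G$ by contracting each $G_i$ to a single vertex (i.e. $G/(E\setminus C)$) is isomorphic to $\Theta_{k_1,k_2,k_3}$, the edges of $C$ forming the three paths. *)

(* Defs.v *)
From HB Require Import structures.
From mathcomp Require Import all_boot all_order all_algebra.
Set Implicit Arguments. Unset Strict Implicit. Unset Printing Implicit Defensive.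
Import Order.TTheory GRing.Theory Num.Theory.

(* Theta_{k1,k2,k3} on vertices 0..k1+k2+k3-2 and edges 0..k1+k2+k3-1.
   u = 0, v = 1; the i-th vertex (0 <= i <= len) on a path with label
   offset [base] is u if i = 0, v if i = len, and base + i otherwise.
   Path 1: base 1, internal vertices 2..k1, edges 0..k1-1.
   Path 2: base k1, internal vertices k1+1..k1+k2-1, edges k1..k1+k2-1.
   Path 3: base k1+k2-1, internal vertices k1+k2..k1+k2+k3-2,
           edges k1+k2..k1+k2+k3-1. *)
Definition theta_pos (base len i : nat) : nat :=
  if i == 0 then 0 else if i == len then 1 else base + i.

Definition theta_ends (k1 k2 k3 e : nat) : nat * nat :=
  if e < k1 then (theta_pos 1 k1 e, theta_pos 1 k1 e.+1)
  else if e < k1 + k2 then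
    (theta_pos k1 k2 (e - k1), theta_pos k1 k2 (e - k1).+1)
  else (theta_pos (k1 + k2 - 1) k3 (e - (k1 + k2)),
        theta_pos (k1 + k2 - 1) k3 (e - (k1 + k2)).+1).

Section Graphs.
Variables (V E : finType) (src tgt : E -> V).

Definition adj (A : {set E}) : rel V := fun x y =>
  [exists e in A, ((src e == x) && (tgt e == y)) || ((src e == y) && (tgt e == x))].

Definition comp (A : {set E}) (x : V) : {set V} := [set y | connect (adj A) x y].

Definition ncomp (A : {set E}) : nat := #|(comp A) @: [set: V]|.

Definition rho (A : {set E}) : nat := #|V| - ncomp A.
Definition gamma (A : {set E}) : nat := #|A| + ncomp A - #|V|.

(* Tutte polynomial as a bivariate polynomial: outer variable x,
   coefficients in {poly int} (variable y). *)
Definition tutte : {poly {poly int}} :=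
  (\sum_(A : {set E})
     (('X - 1) ^+ (rho [set: E] - rho A) *
      (((('X - 1) ^+ gamma A) : {poly int})%:P)))%R.

Definition tcoef (i j : int) : int :=
  match i, j with
  | Posz a, Posz b => ((tutte`_a)`_b)%R
  | _, _ => 0%R
  end.

Definition bridgeless (H : {set E}) : bool :=
  [forall e in H, ncomp (H :\ e) == ncomp H].

(* C is a series class of the bridgeless graph (V, H): removing C splits
   (the component containing C) into |C| pieces, i.e. c(H - C) = c(H) + |C| - 1,
   and H - C is bridgeless. *)
Definition series_class (H C : {set E}) : bool :=
  [&& C \subset H, ncomp (H :\: C) + 1 == ncomp H + #|C| & bridgeless (H :\: C)].

Definition series_classes (H : {set E}) : {set {set E}} :=
  [set C : {set E} | series_class H C].

Definition s_num (H : {set E}) : nat := #|series_classes H|.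
Definition s_star (H : {set E}) : nat :=
  #|[set C in series_classes H | 1 < #|C|]|.

(* C is a Theta class of G = (V, E). The contraction G/(E\C) has as vertices
   the components of (V, E\C) and as edges the elements of C, edge e joining
   the components of src e and tgt e.  The isomorphism with Theta_{k1,k2,k3}
   is given by a bijection f from {0..k-2} onto the components and a
   bijection g from {0..k-1} onto C preserving incidence. *)
Definition theta_class (C : {set E}) : Prop :=
  exists k1 k2 k3 : nat,
    let k := k1 + k2 + k3 in
    [/\ 0 < k1, 0 < k2, 0 < k3, #|C| = k &
    [/\ ncomp (~: C) = k.-1, bridgeless (~: C) &
    exists (f : nat -> {set V}) (g : nat -> E),
      [/\ forall i j, i < k.-1 -> j < k.-1 -> f i = f j -> i = j,
          (fun i : 'I_k.-1 => f (val i)) @: [set: 'I_k.-1]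
            = (comp (~: C)) @: [set: V],
          forall i j, i < k -> j < k -> g i = g j -> i = j,
          (fun i : 'I_k => g (val i)) @: [set: 'I_k] = C &
          forall e, e < k ->
            [set f (theta_ends k1 k2 k3 e).1; f (theta_ends k1 k2 k3 e).2]
            = [set comp (~: C) (src (g e)); comp (~: C) (tgt (g e))]]]].

End Graphs.

(* Main.v *)
Require Import Defs.
From HB Require Import structures.
From mathcomp Require Import all_boot all_order all_algebra.
From mathcomp Require Import zify ring.
Import Order.TTheory GRing.Theory Num.Theory.
Set Implicit Arguments. Unset Strict Implicit. Unset Printing Implicit Defensive.

(** Write [r = m - n + 1]. Complementing the edge sets in the defining sum turns
    [T(G; x, y)] into [sum_B (x - 1)^(|B| - rk B) (y - 1)^(r - rk B)], where [rk]
    is the rank function of the dual of the cycle matroid. Only the sets [B] of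
    rank at most 2 contribute to the coefficients of [y^r], [y^(r-1)] and
    [y^(r-2)]; they are grouped by the flat they span. The flats of rank 1
    (points) are the series classes, and a flat of rank 2 (line) containing [p]
    points contributes [p - 1] to the coefficient of [x^0] and [p - 2] plus its
    number of non-trivial points to that of [x^1].

    A line [F] has 2 or 3 points, and 3 exactly when it is a Theta class: if [C]
    is a point of [F], then [F \ C] is a cycle in the contraction of [E \ F],
    and [C] is a path between two vertices [u], [v] of this cycle. If [u = v]
    then [F \ C] is a point and [p = 2]; otherwise [F] is a Theta. Counting pairs
    of points on lines gives [C(s, 2) = (number of lines) + 2 Theta(G)]. *)

Lemma set_ind (T : finType) (P : {set T} -> Prop) :
  P set0 -> (forall x (A : {set T}), x \notin A -> P A -> P (x |: A)) -> forall A, P A.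
Proof.
move=> P0 PU A; have [n] := ubnP #|A|; elim: n A => // n IHn A.
have [->//|[x xA]] := set_0Vmem A; rewrite (cardsD1 x) xA => leAn.
by rewrite -(setD1K xA); apply: PU; [rewrite setD11 | apply: IHn].
Qed.

(** * Components of spanning subgraphs when edges are added *)

Section Connectivity.
Variables (V E : finType) (src tgt : E -> V).
Implicit Types (A B D : {set E}) (x y u v : V) (e : E).

Local Notation "x ~[ A ] y" := (connect (adj src tgt A) x y)
  (at level 70, A at level 200, y at next level).
Local Notation c := (ncomp src tgt).

Lemma connect_stable (T : finType) (r : rel T) (P : T -> Prop) (x y : T) :
  P x -> (forall a b, P a -> r a b -> P b) -> connect r x y -> P y.
Proof.
move=> Px stab /connectP[p + ->]; elim: p x Px => //= z p IHp x Px /andP[xz].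
by apply: IHp; apply: stab xz.
Qed.

Lemma adjP A x y :
  reflect (exists2 e, e \in A & (src e = x /\ tgt e = y) \/ (src e = y /\ tgt e = x))
          (adj src tgt A x y).
Proof.
apply: (iffP existsP) => [[e /andP[eA /orP[]/andP[/eqP<- /eqP<-]]]|[e eA h]].
- by exists e => //; left.
- by exists e => //; right.
by exists e; rewrite eA /=; case: h => -[-> ->]; rewrite !eqxx ?orbT.
Qed.

Lemma adj_sym A : symmetric (adj src tgt A).
Proof. by move=> x y; apply/adjP/adjP => -[e eA h]; exists e => //; tauto. Qed.

Lemma conn_sym A : connect_sym (adj src tgt A).
Proof. exact/sym_connect_sym/adj_sym. Qed.

Lemma conn_trans A : transitive (connect (adj src tgt A)).
Proof. exact: connect_trans. Qed.

Lemma conn_edge A e : e \in A -> src e ~[A] tgt e.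
Proof. by move=> eA; apply/connect1/adjP; exists e => //; left. Qed.

Lemma conn_sub A B x y : A \subset B -> x ~[A] y -> x ~[B] y.
Proof.
move=> /subsetP sAB; apply: (connect_stable (P := fun b => x ~[B] b)) => // a b xa /adjP[e eA h].
by apply: connect_trans xa _; apply/connect1/adjP; exists e => //; apply: sAB.
Qed.

Lemma comp_eq A x y : (Defs.comp src tgt A x == Defs.comp src tgt A y) = (x ~[A] y).
Proof.
apply/eqP/idP => [/setP/(_ y)|xy]; first by rewrite !inE connect0.
by apply/setP => z; rewrite !inE (same_connect (@conn_sym A) xy).
Qed.

Lemma comp_in A x : Defs.comp src tgt A x \in Defs.comp src tgt A @: [set: V].
Proof. by rewrite imset_f. Qed.

(** A path can be taken to cross the new edge at most once, in one of the two directions. *)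
Lemma conn_add A e x y : x ~[e |: A] y =
  [|| x ~[A] y, (x ~[A] src e) && (tgt e ~[A] y) | (x ~[A] tgt e) && (src e ~[A] y)].
Proof.
have sub a b : a ~[A] b -> a ~[e |: A] b by apply/conn_sub/subsetUr.
have Ee : src e ~[e |: A] tgt e by apply: conn_edge; rewrite setU11.
apply/idP/idP; last first.
  case/or3P => [/sub//|/andP[/sub xs /sub ty]|/andP[/sub xt /sub sy]].
    exact: conn_trans xs (conn_trans Ee ty).
  by apply: conn_trans xt (conn_trans _ sy); rewrite conn_sym.
apply: (connect_stable (P := fun b => is_true
  [|| x ~[A] b, (x ~[A] src e) && (tgt e ~[A] b) | (x ~[A] tgt e) && (src e ~[A] b)]));
  first by rewrite connect0.
move=> a b Pa /adjP[e' + h].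
rewrite in_setU1 => /predU1P[e'E|e'A]; last first.
  have ab : a ~[A] b.
    by case: h => -[<- <-]; last rewrite conn_sym; apply: conn_edge.
  by case/or3P: Pa => [xa|/andP[-> ta]|/andP[-> ta]];
     rewrite ?(conn_trans xa ab) ?(conn_trans ta ab) ?orbT.
case: h => -[ea eb]; move: Pa; rewrite -ea -eb e'E !connect0 !andbT.
- by case/or3P => [->|/andP[-> _]|->]; rewrite ?orbT.
- by case/or3P => [->|->|/andP[-> _]]; rewrite ?orbT.
Qed.

Lemma ncomp_add_conn A e :
  src e ~[A] tgt e -> c (e |: A) = c A.
Proof.
move=> st; rewrite /ncomp (eq_imset (g := Defs.comp src tgt A)) // => x.
apply/setP => y; rewrite !inE conn_add.
apply/or3P/idP => [[//|/andP[xs ty]|/andP[xt sy]]|xy]; last by constructor 1.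
- exact: conn_trans xs (conn_trans st ty).
- by apply: conn_trans xt (conn_trans _ sy); rewrite conn_sym.
Qed.

Lemma ncomp_add_nconn A e :
  ~~ (src e ~[A] tgt e) -> (c (e |: A)).+1 = c A.
Proof.
set K := Defs.comp src tgt; set s := src e; set t := tgt e => nst.
(* [h] sends a component of [A] to the component of [e |: A] containing it; it is injective once the
   component of [tgt e] is left out. *)
pose h X := if (X == K A s) || (X == K A t) then K A s :|: K A t else X.
have hE x : K (e |: A) x = h (K A x).
  rewrite /h !comp_eq; apply/setP => y; rewrite inE conn_add -/s -/t.
  case: ifP => [xst|/norP[/negPf-> /negPf->]]; last by rewrite !orbF inE.
  rewrite !inE; case/orP: xst => xx.
  - have xt : x ~[A] t = false.
      by apply/negP => xt; case/negP: nst; apply: conn_trans xt; rewrite conn_sym.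
    by rewrite xx xt /= orbF (same_connect (@conn_sym A) xx).
  - have xs : x ~[A] s = false.
      by apply/negP => xs; case/negP: nst; apply: conn_trans xx; rewrite conn_sym.
    by rewrite xx xs /= (same_connect (@conn_sym A) xx) orbC.
have KA x : K A x \in K A @: [set: V] := comp_in A x.
have nKK : K A s != K A t by rewrite comp_eq.
rewrite /ncomp -/K [RHS](cardsD1 (K A t)) KA add1n; congr _.+1.
rewrite (eq_imset _ hE) imset_comp -[RHS](card_in_imset (f := h)).
  congr #|pred_of_set _|; apply/setP => X; apply/imsetP/imsetP => [[Y YA ->]|[Y]]; last first.
    by rewrite inE => /andP[_ YA] ->; exists Y.
  have [->|nY] := eqVneq Y (K A t); last by exists Y => //; rewrite !inE nY.
  by exists (K A s); rewrite ?inE ?nKK ?KA // /h !eqxx orbT.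
have nU x : K A x = K A s :|: K A t -> x ~[A] s /\ x ~[A] t.
  by move=> /setP E1; have := E1 s; have := E1 t; rewrite !inE !connect0 orbT.
move=> X Y; rewrite !inE => /andP[nX /imsetP[x _ XE]] /andP[nY /imsetP[y _ YE]].
rewrite /h (negPf nX) (negPf nY) !orbF.
case: eqP => [->|_]; case: eqP => [->|_] //.
- move=> /esym; rewrite YE => /nU[_ yt].
  by case/negP: nY; rewrite YE comp_eq.
- rewrite XE => /nU[_ xt]; by case/negP: nX; rewrite XE comp_eq.
Qed.

Lemma ncomp_add_le A e : c (e |: A) <= c A <= (c (e |: A)).+1.
Proof.
have [st|nst] := boolP (src e ~[A] tgt e).
  by rewrite ncomp_add_conn // leqnn leqnSn.
by rewrite -(ncomp_add_nconn nst) leqnSn leqnn.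
Qed.

Lemma ncomp_drop A D : c (A :|: D) <= c A <= c (A :|: D) + #|D|.
Proof.
elim/set_ind: D => [|e D eD IH]; first by rewrite setU0 cards0 addn0 leqnn.
have := ncomp_add_le (A :|: D) e; rewrite cardsU1 eD setUCA; lia.
Qed.
End Connectivity.

(** * Alternating sums over the subsets of a finite set *)

Section AlternatingSums.
Local Open Scope ring_scope.
Variable E : finType.
Implicit Types (B C : {set E}) (e : E).

Lemma sum_subsetU1 (R : zmodType) (f : {set E} -> R) e C : e \notin C ->
  \sum_(B : {set E} | B \subset e |: C) f B
    = \sum_(B : {set E} | B \subset C) (f B + f (e |: B)).
Proof.
move=> eC; rewrite (bigID (fun B : {set E} => e \in B)) /= addrC big_split /=.
congr (_ + _).
  by apply: eq_bigl => B; rewrite -[C in RHS](setU1K eC) subsetD1.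
rewrite (reindex_onto (fun B => e |: B) (fun B => B :\ e)) /=; last first.
  by move=> B /andP[_ eB]; rewrite setD1K.
apply: eq_bigl => B; rewrite setU11 andbT; apply/andP/idP => [[sB /eqP <-]|sB].
  by rewrite subDset.
have eB : e \notin B by apply: contra eC; apply: subsetP.
by rewrite setUS // setU1K.
Qed.

(** Adding and removing a fixed element of [C] pairs subsets of opposite signs. *)
Lemma sum_sign_subset C : C != set0 ->
  \sum_(B : {set E} | B \subset C) (-1) ^+ #|B| = 0 :> int.
Proof.
case/set0Pn => e eC; rewrite -(setD1K eC) sum_subsetU1 ?setD11 //.
apply: big1 => B; rewrite subsetD1 => /andP[_ eB].
by rewrite cardsU1 eB add1n exprS mulN1r subrr.
Qed.

(** In each pair the cardinalities differ by 1, which leaves an alternating sum over the subsets of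
    [C :\ e]; it vanishes unless this set is empty. *)
Lemma sum_sign_card_subset C : C != set0 ->
  \sum_(B : {set E} | B \subset C) (-1) ^+ #|B| * #|B|%:Z = - (#|C| == 1)%N%:Z.
Proof.
case/set0Pn => e eC; rewrite (cardsD1 e) eC -{1}(setD1K eC).
rewrite sum_subsetU1 ?setD11 // -[_ == _]/(#|C :\ e| == 0)%N cards_eq0.
transitivity (- \sum_(B : {set E} | B \subset C :\ e) (-1) ^+ #|B| : int).
  rewrite -sumrN; apply: eq_bigr => B; rewrite subsetD1 => /andP[_ eB].
  by rewrite cardsU1 eB add1n exprS intS; ring.
congr (- _); have [->|/sum_sign_subset//] := eqVneq.
rewrite (big_pred1 set0) ?cards0 // => B; exact: subset0.
Qed.
End AlternatingSums.

(** Rank axioms in a local form that can be checked one edge at a time; the third condition stands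
    for submodularity. *)
Record loopless_rank (E : finType) (rk : {set E} -> nat) : Prop := LooplessRank {
  _ : rk set0 = 0;
  _ : forall e A, rk A <= rk (e |: A) <= (rk A).+1;
  _ : forall e (A B : {set E}),
        A \subset B -> rk (e |: A) = rk A -> rk (e |: B) = rk B;
  _ : forall e, rk [set e] = 1 }.

(** * Closure, flats, points and lines of a loopless matroid *)

Section Matroid.
Variables (E : finType) (rk : {set E} -> nat).
Hypothesis M : loopless_rank rk.
Implicit Types (A B C D F : {set E}) (e : E).

Lemma rk0 : rk set0 = 0.
Proof. by case: M. Qed.

Lemma rkU1 e A : rk A <= rk (e |: A) <= (rk A).+1.
Proof. by case: M. Qed.

Lemma rk_local e A B : A \subset B -> rk (e |: A) = rk A -> rk (e |: B) = rk B.
Proof. by case: M => _ _ h _; apply: h. Qed.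

Lemma rk1 e : rk [set e] = 1.
Proof. by case: M. Qed.

Lemma rk_sub A B : A \subset B -> rk A <= rk B.
Proof.
move/setUidPr <-; elim/set_ind: B => [|e D _ IH]; first by rewrite setU0.
by rewrite setUCA; have /andP[? _] := rkU1 e (A :|: D); lia.
Qed.

Lemma rk_le_card A : rk A <= #|A|.
Proof.
elim/set_ind: A => [|e D eD IH]; first by rewrite rk0.
by rewrite cardsU1 eD; have /andP[_ ?] := rkU1 e D; lia.
Qed.

Lemma rk_eq0 A : (rk A == 0) = (A == set0).
Proof.
have [->|[e eA]] := set_0Vmem A; first by rewrite rk0 !eqxx.
have := @rk_sub [set e] A; rewrite sub1set rk1 => /(_ eA).
by have [->|] := eqVneq A set0; [rewrite rk0 | lia].
Qed.

Lemma rk_absorb A D : (forall e, e \in D -> rk (e |: A) = rk A) -> rk (A :|: D) = rk A.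
Proof.
elim/set_ind: D => [|e D _ IH] h; first by rewrite setU0.
rewrite setUCA (@rk_local e A) ?subsetUl //; last by apply: h; rewrite setU11.
by apply: IH => e' e'D; apply: h; rewrite inE e'D orbT.
Qed.

Definition mclosure A := [set e | rk (e |: A) == rk A].
Definition flat F := mclosure F \subset F.
Definition flats k := [set F | flat F & rk F == k].
Definition points F := [set C in flats 1 | C \subset F].

Lemma sub_mclosure A : A \subset mclosure A.
Proof. by apply/subsetP => e eA; rewrite inE (setUidPr _) // sub1set. Qed.

Lemma rk_mclosure A : rk (mclosure A) = rk A.
Proof.
rewrite -(setUidPr (sub_mclosure A)); apply: rk_absorb => e.
by rewrite inE => /eqP.
Qed.

Lemma mclosure_sub A B : A \subset B -> mclosure A \subset mclosure B.
Proof.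
move=> sAB; apply/subsetP => e; rewrite !inE => /eqP h.
by rewrite (rk_local sAB).
Qed.

Lemma flat_mclosure A : flat (mclosure A).
Proof.
apply/subsetP => e; rewrite !inE rk_mclosure => /eqP h.
have := rk_sub (setUS [set e] (sub_mclosure A)); rewrite h.
by have /andP[] := rkU1 e A; lia.
Qed.

Lemma mclosure_subE A F : flat F -> (mclosure A \subset F) = (A \subset F).
Proof.
move=> fF; apply/idP/idP => [|/mclosure_sub/subset_trans]; last exact.
exact/subset_trans/sub_mclosure.
Qed.

Lemma mclosure_eq A F : flat F -> A \subset F -> rk A = rk F -> mclosure A = F.
Proof.
move=> fF sAF rAF; apply/eqP; rewrite eqEsubset mclosure_subE // sAF.
apply/subsetP => e eF; rewrite inE.
have := @rk_sub (e |: A) F; rewrite subUset sub1set eF => /(_ sAF).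
by have /andP[] := rkU1 e A; lia.
Qed.

Lemma mclosure_flats A k : rk A = k -> mclosure A \in flats k.
Proof. by move=> <-; rewrite inE flat_mclosure rk_mclosure eqxx. Qed.

Lemma flats_mclosure A F k : F \in flats k -> A \subset F -> rk A = k -> mclosure A = F.
Proof. by rewrite inE => /andP[fF /eqP <-] sAF; apply: mclosure_eq. Qed.

(** Each rank-[k] subset of [F] spans exactly one rank-[k] flat, its closure, and this flat lies in
    [F]. *)
Lemma sum_flat (R : zmodType) (f : {set E} -> R) F k : flat F ->
  (\sum_(B : {set E} | (B \subset F) && (rk B == k)) f B
    = \sum_(C in flats k | C \subset F)
        \sum_(B : {set E} | (B \subset C) && (rk B == k)) f B)%R.
Proof.
move=> fF.
rewrite (partition_big mclosure (fun C => (C \in flats k) && (C \subset F))) /=.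
  apply: eq_bigr => C /andP[Ck sCF]; apply: eq_bigl => B.
  apply/idP/idP => [/andP[/andP[_ ->] /eqP <-]|/andP[sBC rB]].
    by rewrite sub_mclosure.
  rewrite (subset_trans sBC sCF) rB /=; apply/eqP.
  exact: flats_mclosure Ck sBC (eqP rB).
by move=> B /andP[sBF /eqP/mclosure_flats->]; rewrite mclosure_subE.
Qed.

Lemma mclosure1 C e : C \in flats 1 -> e \in C -> mclosure [set e] = C.
Proof. by move=> C1 eC; apply: flats_mclosure C1 _ _; rewrite ?sub1set ?rk1. Qed.

Lemma flat_ne0 k C : C \in flats k.+1 -> C != set0.
Proof. by rewrite inE -rk_eq0 => /andP[_ /eqP->]. Qed.

Lemma points_eq C C' e : C \in flats 1 -> C' \in flats 1 -> e \in C -> e \in C' -> C = C'.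
Proof. by move=> C1 C1' /(mclosure1 C1)<- /(mclosure1 C1')<-. Qed.

(** One element of [C'] outside [C] raises the rank to 2; the rest of [C'] lies in its closure and
    adds nothing. *)
Lemma rk_points C C' : C \in flats 1 -> C' \in flats 1 -> C != C' -> rk (C :|: C') = 2.
Proof.
move=> C1 C1' nCC'.
have [e' e'C'] := set0Pn _ (flat_ne0 C1').
have e'C : e' \notin C by apply: contra nCC' => e'C; rewrite (points_eq C1 C1' e'C e'C').
move: (C1); rewrite inE => /andP[fC /eqP rC].
have r2 : rk (e' |: C) = 2.
  have := subsetP fC e'; rewrite (negPf e'C) inE rC.
  by have /andP[] := rkU1 e' C; rewrite rC; case: eqP => [_ _ _ /(_ isT)//|]; lia.
have : C :|: C' \subset mclosure (e' |: C).
  rewrite subUset (subset_trans _ (sub_mclosure _)) ?subsetUr //.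
  by rewrite -(mclosure1 C1' e'C') mclosure_sub // subsetUl.
move/rk_sub; rewrite rk_mclosure r2.
have : e' |: C \subset C :|: C' by rewrite setUC setUS ?sub1set.
by move/rk_sub; rewrite r2; lia.
Qed.

Lemma line_other_point F C : F \in flats 2 -> C \in flats 1 ->
  exists2 C', C' \in points F & C' != C.
Proof.
move=> F2 C1; have /subsetPn[e eF eC] : ~~ (F \subset C).
  apply/negP => /rk_sub; move: F2 C1; rewrite !inE => /andP[_ /eqP->] /andP[_ /eqP->] //.
have fF : flat F by move: F2; rewrite inE => /andP[].
exists (mclosure [set e]).
  by rewrite inE (mclosure_flats (rk1 e)) mclosure_subE // sub1set.
by apply: contra eC => /eqP <-; apply: (subsetP (sub_mclosure _)); rewrite set11.
Qed.

Lemma line_points_ge2 F : F \in flats 2 -> 2 <= #|points F|.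
Proof.
move=> F2; have [e eF] := set0Pn _ (flat_ne0 F2).
have [C' C'F nC'] := line_other_point F2 (mclosure_flats (rk1 e)).
apply/card_gt1P; exists (mclosure [set e]), C'; split=> //; last by rewrite eq_sym.
move: F2; rewrite !inE => /andP[fF _].
by rewrite flat_mclosure rk_mclosure rk1 mclosure_subE // sub1set.
Qed.

(* The lines through a point partition the other points. *)
Lemma points_through C : C \in flats 1 ->
  #|flats 1|.-1 = \sum_(F in flats 2 | C \subset F) #|points F|.-1.
Proof.
move=> C1; rewrite (cardsD1 C) C1 add1n /= -sum1_card.
rewrite (partition_big (fun C' => mclosure (C :|: C'))
          (fun F => (F \in flats 2) && (C \subset F))) /=; last first.
  move=> C' /setD1P[nC' C1']; rewrite inE flat_mclosure rk_mclosure.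
  rewrite rk_points // 1?eq_sym //.
  by rewrite (subset_trans (subsetUl _ _) (sub_mclosure _)).
apply: eq_bigr => F /andP[F2 sCF]; rewrite (cardsD1 C (points F)).
have -> : C \in points F by rewrite inE C1.
rewrite sum1_card add1n /=; apply: eq_card => C'; rewrite !inE unfold_in.
rewrite !inE -!andbA; apply: andb_id2l => nC'; rewrite andbA [in RHS]andbA.
apply: andb_id2l => C1'; move: (F2); rewrite inE => /andP[fF rF].
have C1f : C' \in flats 1 by rewrite inE.
apply/eqP/idP => [<-|sC'F].
  by rewrite (subset_trans (subsetUr _ _) (sub_mclosure _)).
by apply: flats_mclosure F2 _ _; rewrite ?subUset ?sCF // rk_points // eq_sym.
Qed.

(** Ordered pairs of distinct points are counted in two ways, each pair lying on a unique line. *)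
Lemma sum_points_lines :
  #|flats 1| * #|flats 1|.-1 = \sum_(F in flats 2) #|points F| * #|points F|.-1.
Proof.
rewrite -sum_nat_const (eq_bigr _ points_through).
rewrite (exchange_big_dep (fun F => F \in flats 2)) /=; last by move=> ? ? _ /andP[].
apply: eq_bigr => F F2; rewrite -sum_nat_const; apply: eq_bigl => C.
by rewrite F2 [RHS]inE.
Qed.

(** * Signed sums over the sets spanning a point or a line *)

Local Open Scope ring_scope.

Lemma sum_rk0 (R : zmodType) (f : {set E} -> R) : \sum_(B | rk B == 0%N) f B = f set0.
Proof. by rewrite (big_pred1 set0) // => B; rewrite rk_eq0. Qed.

(** Every nonempty subset of a point has rank 1. *)
Lemma sum_point (R : zmodType) (f : {set E} -> R) C : C \in flats 1 ->
  \sum_(B : {set E} | (B \subset C) && (rk B == 1%N)) f B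
    = \sum_(B : {set E} | B \subset C) f B - f set0.
Proof.
move=> C1; rewrite [in RHS](bigD1 set0) ?sub0set //= addrC addrK.
apply: eq_bigl => B; apply: andb_id2l => sBC; rewrite -rk_eq0.
have := rk_sub sBC; move: C1; rewrite inE => /andP[_ /eqP->].
by case: (rk B) => [|[]].
Qed.

(** A subset of a line is empty, or has rank 1 and lies in a unique point, or has rank 2. *)
Lemma sum_line (R : zmodType) (f : {set E} -> R) F : F \in flats 2 ->
  \sum_(B : {set E} | (B \subset F) && (rk B == 2%N)) f B
    = \sum_(B : {set E} | B \subset F) f B - f set0
      - \sum_(C in points F) (\sum_(B : {set E} | B \subset C) f B - f set0).
Proof.
move=> F2; move: (F2); rewrite inE => /andP[fF /eqP rF].
have -> : \sum_(C in points F) (\sum_(B : {set E} | B \subset C) f B - f set0)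
    = \sum_(B : {set E} | (B \subset F) && (rk B == 1%N)) f B.
  rewrite sum_flat //; apply: eq_big => [C|C]; rewrite inE // => /andP[C1 _].
  by rewrite sum_point.
rewrite [in RHS](bigD1 set0) ?sub0set //= [f set0 + _]addrC addrK.
rewrite [in RHS](bigID (fun B => rk B == 2%N)) /= -addrA -[LHS]addr0.
have rkF B : B \subset F -> (rk B <= 2)%N by move/rk_sub; rewrite rF.
congr (_ + _).
  apply: eq_bigl => B; rewrite -andbA; apply: andb_id2l => /rkF.
  by rewrite -rk_eq0; case: (rk B) => [|[|[]]].
apply/esym/eqP; rewrite subr_eq0; apply/eqP/eq_bigl => B; rewrite -andbA.
apply: andb_id2l => /rkF.
by rewrite -rk_eq0; case: (rk B) => [|[|[]]].
Qed.

Definition nontrivial F := [set C in points F | (1 < #|C|)%N].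

Lemma sum_sign_point C : C \in flats 1 ->
  \sum_(B : {set E} | (B \subset C) && (rk B == 1%N)) (-1) ^+ (#|B| - rk B) = 1 :> int.
Proof.
move=> C1; rewrite (eq_bigr (fun B : {set E} => - (-1) ^+ #|B|)); last first.
  move=> B /andP[_ /eqP rB]; have := rk_le_card B; rewrite rB => B0.
  by rewrite -[in RHS](subnK B0) addn1 exprS mulN1r opprK.
by rewrite sum_point // sumrN sum_sign_subset ?(flat_ne0 C1) // cards0 expr0; lia.
Qed.

(** Rank 2 does not affect the sign. The full alternating sum vanishes, the empty set costs 1, and
    each point gives 1 back. *)
Lemma sum_sign_line F : F \in flats 2 ->
  \sum_(B : {set E} | (B \subset F) && (rk B == 2%N)) (-1) ^+ (#|B| - rk B)
    = #|points F|%:Z - 1.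
Proof.
move=> F2; rewrite (eq_bigr (fun B : {set E} => (-1) ^+ #|B|)); last first.
  move=> B /andP[_ /eqP rB]; have := rk_le_card B; rewrite rB => B0.
  by rewrite -[in RHS](subnK B0) addn2 !exprS !mulN1r opprK.
rewrite sum_line // sum_sign_subset ?(flat_ne0 F2) // cards0 expr0.
rewrite (eq_bigr (fun _ => -1)) ?sumr_const; first by rewrite mulNrn; lia.
by move=> C; rewrite inE => /andP[C1 _]; rewrite sum_sign_subset ?(flat_ne0 C1).
Qed.

(** The summand is the coefficient of $x$ in the power of $x-1$ with exponent [#|B| - rk B]. *)
Lemma sum_deriv_point C : C \in flats 1 ->
  \sum_(B : {set E} | (B \subset C) && (rk B == 1%N))
     - (-1) ^+ (#|B| - rk B) * (#|B| - rk B)%N%:Z = (1 < #|C|)%N%:Z.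
Proof.
move=> C1; rewrite (eq_bigr (fun B : {set E} => (-1) ^+ #|B| * #|B|%:Z - (-1) ^+ #|B|)).
  rewrite sum_point // sumrB sum_sign_subset ?(flat_ne0 C1) //.
  rewrite sum_sign_card_subset ?(flat_ne0 C1) // cards0 expr0.
  by have := flat_ne0 C1; rewrite -cards_eq0; case: #|C| => [|[]].
move=> B /andP[_ /eqP rB]; have := rk_le_card B; rewrite rB => B0.
by rewrite -{3 4 5}(subnK B0) addn1 exprS intS; ring.
Qed.

Lemma sum_deriv_line F : F \in flats 2 ->
  \sum_(B : {set E} | (B \subset F) && (rk B == 2%N))
     - (-1) ^+ (#|B| - rk B) * (#|B| - rk B)%N%:Z
  = #|points F|%:Z - 2 + #|nontrivial F|%:Z.
Proof.
move=> F2.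
rewrite (eq_bigr (fun B : {set E} => 2 * (-1) ^+ #|B| - (-1) ^+ #|B| * #|B|%:Z)).
  (* A line has at least two elements, so the singleton term of [sum_sign_card_subset] does not
     occur for [F]. *)
  have F1 : (#|F| == 1%N) = false.
    have := rk_le_card F; move: F2; rewrite inE => /andP[_ /eqP->].
    by case: #|F| => [|[]].
  rewrite sum_line // sumrB -mulr_sumr sum_sign_subset ?(flat_ne0 F2) //.
  rewrite sum_sign_card_subset ?(flat_ne0 F2) // F1 cards0 expr0.
  (* For a point that term does occur: it contributes -1 if it is a singleton and -2 otherwise. *)
  rewrite (eq_bigr (fun C : {set E} => - 1 - (1 < #|C|)%N%:Z)).
    have -> : #|nontrivial F|%:Z = \sum_(C in points F) (1 < #|C|)%N%:Z.
      rewrite -sum1_card -natz natr_sum (eq_bigl (fun C => (C \in points F) && (1 < #|C|)%N)).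
        by rewrite big_mkcondr; apply: eq_bigr => C _; case: ltnP.
      by move=> C; rewrite [LHS]inE.
    rewrite sumrB sumr_const mulNrn natz /=; move: (\sum_(_ in _) _) => S; lia.
  move=> C; rewrite inE => /andP[C1 _].
  rewrite sumrB -mulr_sumr sum_sign_subset ?(flat_ne0 C1) //.
  rewrite sum_sign_card_subset ?(flat_ne0 C1) //.
  by have := flat_ne0 C1; rewrite -cards_eq0; case: #|C| => [|[]].
move=> B /andP[_ /eqP rB]; have := rk_le_card B; rewrite rB => B0.
by rewrite -{3 4 5}(subnK B0) addn2 !exprS !intS; ring.
Qed.
End Matroid.

Lemma eq_set2 (T : finType) (a b c d : T) :
  ([set a; b] == [set c; d]) = ((a == c) && (b == d)) || ((a == d) && (b == c)).
Proof.
apply/eqP/idP => [/setP h|/orP[]/andP[/eqP-> /eqP->] //]; last by rewrite setUC.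
have := h a; have := h b; have := h c; have := h d.
rewrite !inE !eqxx ?orbT /= (eq_sym c a) (eq_sym d a) (eq_sym c b) (eq_sym d b).
by do 4![case: (_ == _)].
Qed.

(** * Walks in the contraction of an edge set *)

Section Walks.
Variables (V E : finType) (src tgt : E -> V).
Implicit Types (A B D : {set E}) (x y u v : V) (e : E) (p q : seq (E * V)).

Local Notation "x ~[ A ] y" := (connect (adj src tgt A) x y)
  (at level 70, A at level 200, y at next level).
Local Notation c := (ncomp src tgt).

(* [e] is an edge between the classes of [x] and [y] in the contraction of [B]. *)
Definition joins B e x y :=
  ((src e ~[B] x) && (tgt e ~[B] y)) || ((src e ~[B] y) && (tgt e ~[B] x)).

(* A walk in the contraction of [B]: the list of its edges, each followed by a
   representative of the class it leads to. *)
Fixpoint walk B x p y :=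
  if p is (e, z) :: p' then joins B e x z && walk B z p' y else x ~[B] y.

Definition wedges p := [set e in map fst p].

Lemma wedges_cons e x p : wedges ((e, x) :: p) = e |: wedges p.
Proof. by apply/setP => e'; rewrite !inE. Qed.

Lemma wedges_cat p q : wedges (p ++ q) = wedges p :|: wedges q.
Proof. by apply/setP => e'; rewrite !inE map_cat mem_cat. Qed.

Lemma joinsC B e x y : joins B e x y = joins B e y x.
Proof. by rewrite /joins orbC. Qed.

(** This is the form in which [theta_class] states incidence. *)
Lemma joinsE B e x y : joins B e x y =
  ([set Defs.comp src tgt B x; Defs.comp src tgt B y]
     == [set Defs.comp src tgt B (src e); Defs.comp src tgt B (tgt e)]).
Proof.
by rewrite eq_sym eq_set2 !comp_eq.
Qed.

Lemma joins_conn B A e x y : joins B e x y -> B \subset A -> e \in A -> x ~[A] y.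
Proof.
move=> j sBA eA; have st := conn_edge src tgt eA.
case/orP: j => /andP[/(conn_sub sBA) h1 /(conn_sub sBA) h2].
  by rewrite conn_sym in h1; apply: conn_trans h1 (conn_trans st h2).
rewrite conn_sym; rewrite conn_sym in h1.
exact: conn_trans h1 (conn_trans st h2).
Qed.

Lemma walk_conn B A x p y :
  walk B x p y -> B \subset A -> wedges p \subset A ->
  x ~[A] y /\ forall z, z \in map snd p -> x ~[A] z.
Proof.
move=> + sBA; elim: p x => [|[e z] p IH] x /=; first by move=> /(conn_sub sBA).
case/andP => j /IH{}IH; rewrite wedges_cons subUset sub1set => /andP[eA /IH[zy h]].
have xz := joins_conn j sBA eA.
split=> [|w]; first exact: conn_trans xz zy.
by rewrite in_cons => /predU1P[->//|/h]; apply: conn_trans.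
Qed.

Lemma walk_start B x x' p y : x ~[B] x' -> walk B x' p y -> walk B x p y.
Proof.
case: p => [|[e z] p] /= xx'; first exact: conn_trans.
case/andP => j ->; rewrite andbT; move: j; rewrite !joinsE.
by rewrite (eqP (_ : Defs.comp src tgt B x' == Defs.comp src tgt B x)) // comp_eq conn_sym.
Qed.

Lemma walk_cat B x p y q z : walk B x p y -> walk B y q z -> walk B x (p ++ q) z.
Proof.
move=> + yz; elim: p x => [|[e w] p IH] x /=; first by move/walk_start; apply.
by case/andP => -> /IH.
Qed.

Lemma walk_split B x p q y : walk B x (p ++ q) y ->
  walk B x p (last x (map snd p)) /\ walk B (last x (map snd p)) q y.
Proof.
elim: p x => [|[e w] p IH] x /=; first by rewrite connect0.
by case/andP => -> /IH.
Qed.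

Lemma walk_rev B x p y : walk B x p y ->
  exists p', [/\ walk B y p' x, wedges p' = wedges p & size p' = size p].
Proof.
elim: p x => [|[e w] p IH] x /=; first by exists [::]; rewrite /= conn_sym.
case/andP => j /IH[p' [wp' ep' sp']]; exists (p' ++ [:: (e, x)]).
rewrite size_cat sp' addn1 wedges_cat ep'; split=> //.
  by apply: walk_cat wp' _; rewrite /= joinsC j connect0.
by apply/setP => e'; rewrite !inE orbC.
Qed.

(** A minimal set [D] joining [x] to [y] over [B] is a path in the contraction: one edge is peeled
    off at the class of [x], and the rest of [D] is again minimal. *)
Lemma min_walk B D x y :
  x ~[B :|: D] y -> (forall e, e \in D -> ~~ (x ~[B :|: D :\ e] y)) ->
  exists p, [/\ walk B x p y, wedges p = D & size p = #|D|].
Proof.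
have [n] := ubnP #|D|; elim: n D x => // n IHn D x leDn xy minD.
have [xyB|nxyB] := boolP (x ~[B] y).
  exists [::]; have [->|[e eD]] := set_0Vmem D.
    by rewrite cards0; split=> //; apply/setP => e; rewrite !inE.
  by case/negP: (minD e eD); apply: conn_sub xyB; apply: subsetUl.
(* Some edge of [D] meets the class of [x]; otherwise this class would be closed under adjacency and
   contain [y]. *)
have [e /andP[eD ex]|no_e] := pickP [pred e in D | (src e ~[B] x) || (tgt e ~[B] x)]; last first.
  case/negP: nxyB; apply: (connect_stable (P := fun z => x ~[B] z) _ _ xy) => //.
  move=> a b xa /adjP[e + h]; rewrite inE => /orP[eB|eD].
    apply: conn_trans xa _; apply/connect1/adjP; by exists e.
  have /negP[] := no_e e; rewrite inE eD /=.
  by case: h => -[-> ->]; rewrite (conn_sym _ _ B a) xa ?orbT.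
set M := B :|: D :\ e.
have sBM : B \subset M by apply: subsetUl.
have BDE : B :|: D = e |: M by rewrite setUCA setD1K.
(* Removing [e] separates [x] from [y], so [y] is reached from the far end [z] of [e]. *)
have [z jz zy] : exists2 z, joins B e x z & z ~[M] y.
  move: xy (minD e eD); rewrite BDE conn_add -/M.
  have xM a : a ~[B] x -> x ~[M] a by rewrite conn_sym; apply: conn_sub.
  case/orP: ex => [sx|tx] /or3P[->//|/andP[xs ty]|/andP[xt sy]] nxy.
  - by exists (tgt e); rewrite // /joins sx connect0.
  - by case/negP: nxy; apply: conn_trans sy; apply: xM.
  - by case/negP: nxy; apply: conn_trans ty; apply: xM.
  - by exists (src e); rewrite // /joins tx connect0 orbT.
have [||p [wp ep sp]] := IHn (D :\ e) z _ zy.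
- by move: leDn; rewrite (cardsD1 e) eD.
(* A connection from [z] that spares [e'] could be preceded by [e], against the minimality of
   [D]. *)
- move=> e'; rewrite !inE => /andP[ne' e'D]; apply: contra (minD _ e'D) => zy'.
  have sub : B :|: D :\ e :\ e' \subset B :|: D :\ e'.
    by rewrite setUS // setSD // subD1set.
  apply: conn_trans (conn_sub sub zy'); apply: joins_conn jz _ _.
    exact: subsetUl.
  by rewrite !inE (eq_sym e) ne' eD orbT.
exists ((e, z) :: p); split; rewrite /= ?jz //.
  by rewrite wedges_cons ep setD1K.
by rewrite sp (cardsD1 e D) eD.
Qed.

(** The walk visits the class of [z] just before or just after the edge [e], and is cut there. *)
Lemma walk_cut B x p y e z : walk B x p y -> e \in wedges p ->
  (src e ~[B] z) || (tgt e ~[B] z) ->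
  exists p1 p2, [/\ p = p1 ++ p2, walk B x p1 z & walk B z p2 y].
Proof.
move=> + + ez; elim: p x => [|[e' w] p IH] x; first by rewrite inE.
rewrite wedges_cons => /= /andP[j wp] /setU1P[ee'|/(IH _ wp)[p1 [p2 [-> wp1 wp2]]]]; last first.
  by exists ((e', w) :: p1), p2; rewrite /= j.
have [xz|wz] : x ~[B] z \/ w ~[B] z.
- have cs a b d : a ~[B] b -> a ~[B] d -> b ~[B] d by rewrite (conn_sym _ _ B a); apply: conn_trans.
  by move: j ez; rewrite -ee' => /orP[]/andP[h1 h2] /orP[h|h]; eauto.
- exists [::], ((e', w) :: p); split=> //.
  by apply: (@walk_start _ _ x); rewrite ?(conn_sym _ _ B z) //= j.
exists [:: (e', w)], p; rewrite /= j; split=> //.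
by apply: walk_start wp; rewrite conn_sym.
Qed.

(* The first edge of the walk closes a cycle, hence does not decrease [ncomp]. *)
Lemma ncomp_add_walk B A u p v :
  walk B u p v -> B \subset A -> u ~[A] v -> p != [::] ->
  c A < c (A :|: wedges p) + size p.
Proof.
case: p => // -[e z] p /= /andP[j wp] sBA uv _.
have le_p : #|wedges p| <= size p.
  by rewrite cardsE -(size_map fst) card_size.
have /andP[_ h] := ncomp_drop src tgt A (wedges p).
rewrite wedges_cons setUCA ncomp_add_conn; first by lia.
have sA : A \subset A :|: wedges p by apply: subsetUl.
have sB := subset_trans sBA sA.
have uz : u ~[A :|: wedges p] z.
  apply: conn_trans (conn_sub sA uv) _; rewrite conn_sym.
  by have [] := walk_conn wp sB (subsetUr _ _).
case/orP: j => /andP[/(conn_sub sB) h1 /(conn_sub sB) h2]; last first.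
  apply: conn_trans h1 _; rewrite conn_sym in h2; rewrite conn_sym in uz.
  exact: conn_trans uz h2.
by apply: conn_trans h1 _; rewrite conn_sym in h2; apply: conn_trans uz h2.
Qed.

(** The [#|S|] distinct classes of [B] met by [S] become one class of [A], and no other class
    splits. *)
Lemma ncomp_merge B A (S : {set V}) x :
  B \subset A -> (forall y, y \in S -> x ~[A] y) ->
  {in S &, injective (Defs.comp src tgt B)} ->
  c A + #|S| <= (c B).+1.
Proof.
move=> sBA Sx injS; set K := Defs.comp src tgt.
pose T := K B @: [set: V]; pose S' := K B @: S.
have S'T : S' \subset T by apply: imsetS; apply: subsetT.
(* The default [x] is never reached on a component, which is nonempty. *)
pose rep (X : {set V}) := odflt x [pick y in X].
have sub : K A @: [set: V] \subset K A x |: ((fun X => K A (rep X)) @: (T :\: S')).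
  apply/subsetP => _ /imsetP[y _ ->]; rewrite in_setU1.
  have repy : K A (rep (K B y)) = K A y.
    apply/eqP; rewrite comp_eq /rep; case: pickP => [z|/(_ y)]; last by rewrite inE connect0.
    by rewrite inE conn_sym => /(conn_sub sBA).
  have [yS|yS] := boolP (K B y \in S').
    case/imsetP: yS => z zS /eqP; rewrite comp_eq => /(conn_sub sBA) yz.
    by rewrite eq_sym comp_eq (conn_trans (Sx z zS)) // conn_sym.
  apply/orP; right; apply/imsetP; exists (K B y); rewrite ?repy //.
  by rewrite inE yS comp_in.
have := subset_leq_card sub; rewrite cardsU1.
have : #|(fun X => K A (rep X)) @: (T :\: S')| <= #|T :\: S'| := leq_imset_card _ _.
have S'E : #|S'| = #|S| by apply: card_in_imset.
have := cardsD T S'; rewrite (setIidPr S'T) S'E => TE.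
have := subset_leq_card S'T; rewrite S'E /ncomp -/T -/K.
rewrite TE; move: #|_| #|T| #|(_ @: _)| => s t a st.
move: #|_| => b; case: (_ \notin _) => /=; lia.
Qed.
End Walks.

(** * The dual of the cycle matroid: series classes as points, cycles in lines *)

Section Cographic.
Variables (V E : finType) (src tgt : E -> V).
Hypothesis conn1 : ncomp src tgt [set: E] = 1.
Hypothesis bless : bridgeless src tgt [set: E].
Implicit Types (A B C D F : {set E}) (x y u v : V) (e : E) (p q : seq (E * V)).

Local Notation "x ~[ A ] y" := (connect (adj src tgt A) x y)
  (at level 70, A at level 200, y at next level).
Local Notation c := (ncomp src tgt).

(* Rank function of the dual of the cycle matroid. *)
Definition corank B := #|B|.+1 - c (~: B).

(** Connectedness makes the truncated subtraction in [corank] exact: deleting [#|B|] edges leaves at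
    most [#|B|.+1] components. *)
Lemma corankE B : corank B + c (~: B) = #|B|.+1.
Proof.
have /andP[_] := ncomp_drop src tgt (~: B) B.
by rewrite setUC setUCr conn1 /corank; lia.
Qed.

Lemma corank0 : corank set0 = 0.
Proof. by have := corankE set0; rewrite setC0 conn1 cards0; lia. Qed.

Lemma setCU1 e A : ~: (e |: A) = ~: A :\ e.
Proof. by apply/setP => e'; rewrite !inE negb_or. Qed.

Lemma corankU1 e A : corank A <= corank (e |: A) <= (corank A).+1.
Proof.
have [eA|eA] := boolP (e \in A); first by rewrite (setUidPr _) ?sub1set ?leqnn ?leqnSn.
have := corankE A; have := corankE (e |: A); rewrite cardsU1 eA setCU1.
by have := ncomp_add_le src tgt (~: A :\ e) e; rewrite setD1K ?inE //; lia.
Qed.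

(** An edge outside [A] keeps the corank exactly when it is a bridge of the complement of [A], and a
    bridge remains one in any smaller subgraph containing it. *)
Lemma corank_local e A B :
  A \subset B -> corank (e |: A) = corank A -> corank (e |: B) = corank B.
Proof.
move=> sAB; have [eB|eB] := boolP (e \in B); first by rewrite [e |: B](setUidPr _) ?sub1set.
have eA : e \notin A by apply: contra eB; apply: subsetP.
have := corankE A; have := corankE (e |: A); rewrite cardsU1 eA setCU1.
have := corankE B; have := corankE (e |: B); rewrite cardsU1 eB setCU1.
have [st|nst] := boolP (src e ~[~: A :\ e] tgt e).
  by have := ncomp_add_conn st; rewrite setD1K ?inE //; lia.
have nst' : ~~ (src e ~[~: B :\ e] tgt e).
  by apply: contra nst; apply: conn_sub; rewrite setSD ?setCS.
have := ncomp_add_nconn nst; have := ncomp_add_nconn nst'.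
by rewrite !setD1K ?inE //; lia.
Qed.

(** The edges that the closure adds to [F] are the bridges of its complement. *)
Lemma flat_bridgeless F : flat corank F = bridgeless src tgt (~: F).
Proof.
apply/subsetP/forall_inP => h e.
  rewrite inE => eF; have := contra (h e) eF; rewrite inE.
  have := corankE F; have := corankE (e |: F); have := corankU1 e F.
  by rewrite cardsU1 eF setCU1 => ? ? ? /eqP ?; apply/eqP; lia.
rewrite inE; apply: contraLR => eF; have := h e; rewrite inE => /(_ eF)/eqP.
have := corankE F; have := corankE (e |: F).
by rewrite cardsU1 eF setCU1 => ? ? ?; apply/eqP; lia.
Qed.

Lemma ncompT1 e : c ([set: E] :\ e) = 1.
Proof. by have /forall_inP/(_ e (in_setT e))/eqP-> := bless. Qed.

Lemma corank1 e : corank [set e] = 1.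
Proof.
by have := corankE [set e]; rewrite cards1 -[~: _]setTD ncompT1; lia.
Qed.

Lemma corankM : loopless_rank corank.
Proof. exact: LooplessRank corank0 corankU1 corank_local corank1. Qed.

(** Leaving [#|C|] components means corank 1, and leaving no bridge means being a flat. *)
Lemma series_classE C : series_class src tgt [set: E] C = (C \in flats corank 1).
Proof.
rewrite inE /series_class subsetT setTD conn1 flat_bridgeless /= andbC.
congr (_ && _). have := corankE C; lia.
Qed.

Lemma series_class_setC A C : A \in flats corank 1 ->
  series_class src tgt (~: A) C = [disjoint A & C] && (A :|: C \in flats corank 2).
Proof.
rewrite inE => /andP[_ /eqP rA].
rewrite /series_class -disjoints_subset disjoint_sym setDE -setCU.
apply: andb_id2l => dAC; rewrite inE flat_bridgeless andbC; congr (_ && _).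
have := corankE A; have := corankE (A :|: C); rewrite cardsU disjoint_setI0 //.
by rewrite cards0; lia.
Qed.

(** Adding [A] maps the series classes of $G-A$ bijectively onto the lines through [A]. *)
Lemma s_num_setC A : A \in flats corank 1 ->
  s_num src tgt (~: A) = #|[set F in flats corank 2 | A \subset F]|.
Proof.
move=> A1; have -> : [set F in flats corank 2 | A \subset F]
    = (fun C => A :|: C) @: series_classes src tgt (~: A).
  apply/setP => F; rewrite inE; apply/andP/imsetP => [[F2 sAF]|[C]].
    exists (F :\: A); last by rewrite setDE setUIr setUCr setIT (setUidPr sAF).
    rewrite inE series_class_setC // setDE setUIr setUCr setIT (setUidPr sAF) F2 andbT.
    by rewrite -setDE disjoints_subset setCD subsetUr.
  by rewrite inE series_class_setC // => /andP[_ AC2] ->; rewrite subsetUl.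
have AK C : [disjoint A & C] -> (A :|: C) :\: A = C.
  by rewrite disjoint_sym => /setDidPl; rewrite setDUl setDv set0U.
rewrite card_in_imset // => C C'; rewrite !inE !series_class_setC //.
by move=> /andP[/AK h _] /andP[/AK h' _] hh; rewrite -h hh.
Qed.

(** As the lengths of the walks add up to [#|F|], each edge of [F] is used exactly once. *)
Definition theta_walks F u v p1 p2 p3 :=
  [/\ walk src tgt (~: F) u p1 v, walk src tgt (~: F) u p2 v, walk src tgt (~: F) u p3 v,
      wedges (p1 ++ p2 ++ p3) = F & size (p1 ++ p2 ++ p3) = #|F|].

Lemma connT x y : x ~[[set: E]] y.
Proof.
have := cards1P (introT eqP conn1) => -[X XE].
have inX z : Defs.comp src tgt [set: E] z = X by apply/set1P; rewrite -XE comp_in.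
by rewrite -comp_eq !inX.
Qed.

Lemma ncomp_line F : F \in flats corank 2 -> (c (~: F)).+1 = #|F|.
Proof. by rewrite inE => /andP[_ /eqP rF]; have := corankE F; lia. Qed.

Lemma ncomp_point C : C \in flats corank 1 -> c (~: C) = #|C|.
Proof. by rewrite inE => /andP[_ /eqP rC]; have := corankE C; lia. Qed.

Lemma flat_not_bridge F k e : F \in flats corank k -> e \notin F ->
  c (~: F :\ e) = c (~: F) /\ src e ~[~: F :\ e] tgt e.
Proof.
rewrite inE => /andP[]; rewrite flat_bridgeless => /forall_inP h _ eF.
have /eqP h1 : c (~: F :\ e) == c (~: F) by apply: h; rewrite inE.
split=> //.
case: (boolP (src e ~[~: F :\ e] tgt e)) => // /ncomp_add_nconn.
by rewrite setD1K ?inE // h1; lia.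
Qed.

(* In the contraction of the complement of the line [F], the edges of [F] outside
   a point [C] form a cycle. *)
Lemma line_cycle F C d0 :
  F \in flats corank 2 -> C \in points corank F -> d0 \in F :\: C ->
  exists q, [/\ walk src tgt (~: F) (src d0) q (src d0), wedges q = F :\: C
              & size q = #|F :\: C|].
Proof.
set B := ~: F; set D := F :\: C => F2; rewrite inE => /andP[C1 sCF] d0D.
have d0C : d0 \notin C by move: d0D; rewrite inE => /andP[].
have BD : B :|: D = ~: C.
  apply/setP => e; rewrite !inE; have := subsetP sCF e.
  by case: (e \in C) (e \in F) => [] [] // /(_ isT).
have BD1 : B :|: D :\ d0 = ~: C :\ d0.
  rewrite -BD setDUl; congr (_ :|: _); apply/setP => e; rewrite !inE.
  by case: eqVneq => //= ->; case/setDP: d0D => ->.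
have cB : (c B).+1 = #|F| := ncomp_line F2; have cC := ncomp_point C1.
have cardD : #|D| = #|F| - #|C| by rewrite cardsD (setIidPr sCF).
have [_ st] := flat_not_bridge C1 d0C.
have [||p [wp ep sp]] := @min_walk _ _ src tgt B (D :\ d0) (tgt d0) (src d0).
- by rewrite BD1 conn_sym.
(* If the ends of [d0] stayed joined without [e], the other [#|D| - 2] edges of [D] would have to
   reduce [#|F| - 1] components to [#|C|], which takes one edge more. *)
- move=> e; rewrite 2!inE => /andP[ne eD]; apply/negP; rewrite conn_sym => st'.
  have eC : e \notin C by move: eD; rewrite inE => /andP[].
  have [ce _] := flat_not_bridge C1 eC.
  have := ncomp_add_conn st'.
  have -> : d0 |: (B :|: (D :\ d0) :\ e) = ~: C :\ e.
    rewrite -BD; apply/setP => e'; rewrite !inE.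
    have [->|n0] := eqVneq e' d0; first by move: d0D; rewrite !inE (eq_sym d0) ne /= => /andP[-> ->]; rewrite orbT.
    have [->|n1] := eqVneq e' e; last by [].
    by move: eD; rewrite !inE => /andP[_ ->].
  have /andP[_] := ncomp_drop src tgt B (D :\ d0 :\ e).
  have eD0 : e \in D :\ d0 by rewrite in_setD1 ne.
  have := cardsD1 e (D :\ d0); have := cardsD1 d0 D; rewrite d0D eD0.
  by have := subset_leq_card sCF; move: cB cC cardD ce; clear; lia.
exists ((d0, tgt d0) :: p); split; rewrite /= ?wp ?andbT //.
- by rewrite /joins !connect0.
- by rewrite wedges_cons ep setD1K.
- by rewrite sp (cardsD1 d0 D) d0D.
Qed.

(** The edges outside a point [C] form a cycle. An edge of [C] leaves it at [u], the rest of [C]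
    leads back to it at [v], and [u] and [v] cut the cycle into the two other walks. *)
Lemma line3_theta_walks F : F \in flats corank 2 -> 2 < #|points corank F| ->
  exists u v p1 p2 p3, theta_walks F u v p1 p2 p3 /\ ~~ (u ~[~: F] v).
Proof.
set B := ~: F => F2 /card_gt2P[C [C2 [C3 [[CF C2F C3F] [nC2 n23 nC3]]]]].
have [C1 sCF] : C \in flats corank 1 /\ C \subset F by apply/andP; rewrite inE in CF.
set D := F :\: C.
have cB : (c B).+1 = #|F| := ncomp_line F2; have cC := ncomp_point C1.
have cardD : #|F| = #|C| + #|D| by rewrite cardsD (setIidPr sCF) subnKC ?subset_leq_card.
have BC : ~: D = B :|: C.
  by rewrite /D setCD.
(* [D] contains two more points, so its corank is at least 2; this is where the third point
   enters. *)
have rD : c (B :|: C) < #|D|.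
  have subD C' : C' \in points corank F -> C != C' -> C' \subset D.
    rewrite inE => /andP[C1' sC'F] nCC'; rewrite subsetD sC'F disjoint_sym.
    apply/pred0P => e; apply/negP => /andP[/= eC eC']; case/eqP: nCC'.
    exact: (points_eq corankM C1 C1' eC eC').
  have sub : C2 :|: C3 \subset D by rewrite subUset !subD // eq_sym.
  have := rk_sub corankM sub.
  have [/setIdP[C2f _] /setIdP[C3f _]] := (C2F, C3F).
  rewrite (rk_points corankM) //.
  by have := corankE D; rewrite BC; clear; lia.
have [d0 d0D] : exists d0, d0 \in D by apply/set0Pn; rewrite -card_gt0; apply: leq_ltn_trans rD.
have [q [wq eq sq]] := line_cycle F2 CF d0D.
have DB e : e \in F -> e \notin C -> e \in D by rewrite inE => -> ->.
(* Selects the vertices whose class lies on the cycle. *)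
pose onq z := [exists e in D, (src e ~[B] z) || (tgt e ~[B] z)].
have onq_end e : e \in D -> onq (src e) /\ onq (tgt e).
  by move=> eD; split; apply/existsP; exists e; rewrite eD connect0 ?orbT.
have onq_conn y z : y ~[B] z -> onq y -> onq z.
  move=> yz /existsP[e /andP[eD h]]; apply/existsP; exists e; rewrite eD /=.
  by case/orP: h => h; rewrite (conn_trans h yz) ?orbT.
(* If no edge of [C] met the cycle, the vertices on it would be closed under adjacency in a
   connected graph. *)
have [e eC e_on] : exists2 e, e \in C & onq (src e) || onq (tgt e).
  have [e /andP[]|none] := pickP [pred e in C | onq (src e) || onq (tgt e)]; first by exists e.
  have [e eC] := set0Pn _ (flat_ne0 corankM C1).
  have /negP[] := none e; rewrite inE eC /=; apply/orP; left.
  apply: (connect_stable (P := onq) _ _ (connT (src d0) (src e))).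
    by have [] := onq_end d0 d0D.
  move=> a b oa /adjP[e' _ h]; have [e'F|e'F] := boolP (e' \in F); last first.
    apply: onq_conn oa; apply/connect1/adjP; exists e' => //; by rewrite inE.
  have [e'C|e'C] := boolP (e' \in C).
    have /negP[] := none e'; rewrite inE e'C.
    by case: h => -[-> ->]; rewrite oa ?orbT.
  have [] := onq_end e' (DB _ e'F e'C).
  by case: h => -[-> ->].
have st : src e ~[[set: E] :\ e] tgt e.
  case: (boolP (src e ~[[set: E] :\ e] tgt e)) => // /ncomp_add_nconn.
  by rewrite setD1K // ncompT1 conn1.
have [u [b [ou bu uE]]] : exists u b, [/\ onq u, b ~[[set: E] :\ e] u &
    (u = src e /\ b = tgt e) \/ (u = tgt e /\ b = src e)].
  case/orP: e_on => h; first by exists (src e), (tgt e); rewrite conn_sym; split; auto.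
  by exists (tgt e), (src e); split; auto.
set N := B :|: C :\ e.
have eN : e |: N = B :|: C by rewrite setUCA setD1K.
(* Otherwise the component of [b] in [N] would avoid the cycle and be closed in the graph without
   [e], where [b] still reaches [u]. *)
have [v /andP[ov bv]|none] := pickP [pred v | onq v && (b ~[N] v)]; last first.
  have /negP[] := none u; rewrite /= ou /=.
  apply: (connect_stable (P := fun z => b ~[N] z) _ _ bu) => // y z by_ /adjP[e'].
  rewrite inE => /andP[ne' _] h; have [e'N|e'N] := boolP (e' \in N).
    by apply: conn_trans by_ _; apply/connect1/adjP; exists e'.
  have e'D : e' \in D.
    by move: e'N; rewrite !inE negb_or negbK negb_and negbK; move: ne'; rewrite inE => /negPf-> /= /andP[-> ->].
  have /negP[] := none y; rewrite /= by_ andbT.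
  by have [] := onq_end e' e'D; case: h => -[-> ->].
(* If [u] and [v] were in one class, [e] would close a cycle in [B :|: C], leaving more components
   than [rD] allows. *)
have nuv : ~~ (u ~[B] v).
  apply/negP => uv; have ub : u ~[N] b.
    by apply: conn_trans (conn_sub (subsetUl _ _) uv) _; rewrite conn_sym.
  have := @ncomp_add_conn _ _ src tgt N e; rewrite eN.
  have -> : src e ~[N] tgt e by case: uE ub => -[-> ->] //; rewrite conn_sym.
  move=> /(_ isT) cN; have /andP[_] := ncomp_drop src tgt B (C :\ e).
  by have := cardsD1 e C; rewrite eC -/N; move: cB cardD cN rD; clear; lia.
have uvC : u ~[B :|: C] v.
  apply: conn_trans (conn_sub (_ : N \subset _) bv); last by rewrite setUS // subD1set.
  have eBC : e \in B :|: C by rewrite inE eC orbT.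
  have := conn_edge src tgt eBC; case: uE => -[-> ->] //; by rewrite conn_sym.
(* The cycle is rotated to start at [u], then cut at [v]. *)
have [r [wr er sr]] : exists r, [/\ walk src tgt B u r u, wedges r = D & size r = #|D|].
  case/existsP: ou => d /andP[dD du].
  have [|q1 [q2 [qE w1 w2]]] := walk_cut wq _ du; first by rewrite eq.
  exists (q2 ++ q1); split; first exact: walk_cat w2 w1.
    by rewrite wedges_cat setUC -wedges_cat -qE.
  by rewrite size_cat addnC -size_cat -qE.
have [r1 [r2 [rE w1 w2]]] : exists r1 r2,
    [/\ r = r1 ++ r2, walk src tgt B u r1 v & walk src tgt B v r2 u].
  by case/existsP: ov => d /andP[dD dv]; apply: walk_cut wr _ dv; rewrite er.
have [r3 [w3 e3 s3]] := walk_rev w2.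
have [|p [wp ep sp]] := @min_walk _ _ src tgt B C u v uvC.
  (* If [u] and [v] stayed joined without [e'], both arcs of the cycle would close further cycles,
     and too few edges would remain to connect the graph without [e']. *)
  move=> e' e'C; apply/negP; set A := B :|: C :\ e' => uvA.
  have r1n : r1 != [::] by case: (r1) w1 nuv => //= ->.
  have r3n : r3 != [::] by case: (r3) w3 nuv => //= ->.
  have sBA : B \subset A by apply: subsetUl.
  have := ncomp_add_walk w1 sBA uvA r1n.
  have sAA : A \subset A :|: wedges r1 by apply: subsetUl.
  have := ncomp_add_walk w3 (subset_trans sBA sAA) (conn_sub sAA uvA) r3n.
  rewrite -setUA e3 -wedges_cat -rE er.
  have -> : A :|: D = [set: E] :\ e'.
    apply/setP => d; rewrite !inE; have := subsetP sCF d.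
    have [->|nd] := eqVneq d e'; first by rewrite e'C /= => ->.
    by case: (d \in C) (d \in F) => [] [].
  rewrite ncompT1.
  have /andP[_] := ncomp_drop src tgt B (C :\ e'); rewrite -/A.
  have := cardsD1 e' C; rewrite e'C; move: sr cB cardD; rewrite rE size_cat -s3; clear; lia.
exists u, v, p, r1, r3; split=> //; split=> //.
  rewrite !wedges_cat ep e3 -wedges_cat -rE er.
  by rewrite /D setDE setUIr setUCr setIT (setUidPr sCF).
by rewrite !size_cat sp s3 -size_cat -rE sr.
Qed.
End Cographic.

(** * Lines made of three walks: their points and their Theta structure *)

Section ThetaWalks.
Variables (V E : finType) (src tgt : E -> V).
Hypothesis conn1 : ncomp src tgt [set: E] = 1.
Hypothesis bless : bridgeless src tgt [set: E].
Implicit Types (A B C D F : {set E}) (x y u v : V) (e : E) (p q r s : seq (E * V)).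

Local Notation "x ~[ A ] y" := (connect (adj src tgt A) x y)
  (at level 70, A at level 200, y at next level).
Local Notation c := (ncomp src tgt).
Local Notation corank := (corank src tgt).
Local Notation K := (Defs.comp src tgt).
Local Notation tw := (theta_walks src tgt).

Lemma theta_walks_rot F u v p q r : tw F u v p q r -> tw F u v q r p.
Proof.
case=> w1 w2 w3 eF sF; split=> //; last by rewrite -sF !size_cat; lia.
by rewrite -eF !wedges_cat setUA setUC.
Qed.

Lemma card_wedges p : #|wedges p| <= size p.
Proof. by rewrite cardsE -(size_map fst) card_size. Qed.

(** When [p] is deleted, [q] still joins [u] to [v] and [r] closes a cycle, so at least [size p]
    components remain. *)
Lemma theta_corank_le1 F u v p q r :
  F \in flats corank 2 -> tw F u v p q r -> r != [::] -> corank (wedges p) <= 1.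
Proof.
move=> F2 [w1 w2 w3 eF sF] r0; set B := ~: F in w1 w2 w3 *.
have cB : (c B).+1 = #|F| := ncomp_line conn1 bless F2.
have sBq : B \subset B :|: wedges q by apply: subsetUl.
have [uvq _] := walk_conn w2 sBq (subsetUr _ _).
have h1 := ncomp_add_walk w3 sBq uvq r0.
have /andP[_ h2] := ncomp_drop src tgt B (wedges q).
have h3 : c (B :|: wedges q :|: wedges r) <= c (~: wedges p).
  have -> : B :|: wedges q :|: wedges r = ~: wedges p :|: (wedges q :|: wedges r).
    rewrite /B -eF !wedges_cat; apply/setP => e; rewrite !in_setU !in_setC !in_setU.
    by case: (e \in wedges p) (e \in wedges q) (e \in wedges r) => [] [] [].
  by have /andP[] := ncomp_drop src tgt (~: wedges p) (wedges q :|: wedges r).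
have := card_wedges p; have := card_wedges q; have := corankE conn1 bless (wedges p).
by move: sF cB h1 h2 h3; rewrite !size_cat; clear; lia.
Qed.

(** By hypothesis every edge of [r] merges two components, so few are left when [p] and [q] are
    deleted. Comparing lengths with [#|F|] shows that [r] shares no edge with them. *)
Lemma theta_corank_ge2 F u v p q r :
  F \in flats corank 2 -> tw F u v p q r ->
  c (~: F :|: wedges r) + size r <= c (~: F) ->
  2 <= corank (wedges p :|: wedges q).
Proof.
move=> F2 [w1 w2 w3 eF sF]; set B := ~: F in w1 w2 w3 * => cr.
have cB : (c B).+1 = #|F| := ncomp_line conn1 bless F2.
have h1 : #|wedges p :|: wedges q| <= size p + size q.
  by rewrite cardsU; have := card_wedges p; have := card_wedges q; lia.
have eF' : (wedges p :|: wedges q) :|: wedges r = F by rewrite -eF !wedges_cat setUA.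
have cI := cardsU (wedges p :|: wedges q) (wedges r).
have dis : [disjoint wedges p :|: wedges q & wedges r].
  rewrite -setI_eq0 -cards_eq0.
  have := subset_leq_card (subsetIr (wedges p :|: wedges q) (wedges r)).
  have := card_wedges r; move: sF cI h1; rewrite eF' !size_cat; clear; lia.
have BE : B :|: wedges r = ~: (wedges p :|: wedges q).
  rewrite /B -eF'; apply/setP => e; rewrite !in_setU !in_setC !in_setU.
  have := disjointFl dis (x := e); rewrite in_setU.
  by case: (e \in wedges p) (e \in wedges q) (e \in wedges r) => [] [] [] // /(_ isT).
move: cI; rewrite eF' (disjoint_setI0 dis) cards0.
have := card_wedges r; have := corankE conn1 bless (wedges p :|: wedges q).
by rewrite -BE; move: cB cr sF; rewrite !size_cat; clear; lia.
Qed.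

(** Each walk has rank 1 and any two have rank 2, so their closures are three distinct points; these
    cover [F], which leaves no room for another. *)
Lemma theta_walks_points F u v p q r :
  F \in flats corank 2 -> tw F u v p q r ->
  p != [::] -> q != [::] -> r != [::] ->
  c (~: F :|: wedges p) + size p <= c (~: F) ->
  c (~: F :|: wedges q) + size q <= c (~: F) ->
  c (~: F :|: wedges r) + size r <= c (~: F) ->
  #|points corank F| = 3.
Proof.
move=> F2 t p0 q0 r0 cp cq cr; have t' := theta_walks_rot t; have t'' := theta_walks_rot t'.
have M := corankM conn1 bless.
have eF : wedges p :|: wedges q :|: wedges r = F.
  by case: t => _ _ _ <- _; rewrite !wedges_cat setUA.
have W1 s : s != [::] -> corank (wedges s) <= 1 -> wedges s \subset F ->
    mclosure corank (wedges s) \in points corank F.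
  case: s => // -[e z] s _ r1 sF; have eW : e \in wedges ((e, z) :: s) by rewrite wedges_cons setU11.
  have := rk_sub M (_ : [set e] \subset wedges ((e, z) :: s)); rewrite sub1set => /(_ eW).
  rewrite (rk1 M) => r1'; rewrite inE (mclosure_flats M); last by apply/eqP; rewrite eqn_leq r1.
  by rewrite (mclosure_subE M) //; move: F2; rewrite inE => /andP[].
have dist s (s' : seq (E * V)) : corank (wedges s) <= 1 -> 2 <= corank (wedges s :|: wedges s') ->
    mclosure corank (wedges s) != mclosure corank (wedges s').
  move=> r1 r2; apply/eqP => h.
  have : wedges s :|: wedges s' \subset mclosure corank (wedges s).
    by rewrite subUset {2}h !sub_mclosure.
  by move/(rk_sub M); rewrite (rk_mclosure M); lia.
have rp := theta_corank_le1 F2 t r0; have rq := theta_corank_le1 F2 t' p0.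
have rr := theta_corank_le1 F2 t'' q0.
have rpq := theta_corank_ge2 F2 t cr; have rqr := theta_corank_ge2 F2 t' cp.
have rrp := theta_corank_ge2 F2 t'' cq.
have sp : wedges p \subset F by rewrite -eF -setUA subsetUl.
have sq : wedges q \subset F by rewrite -eF setUAC subsetUr.
have sr : wedges r \subset F by rewrite -eF subsetUr.
have clE s C e : s != [::] -> corank (wedges s) <= 1 -> wedges s \subset F ->
    C \in flats corank 1 -> e \in C -> e \in wedges s -> C = mclosure corank (wedges s).
  move=> s0 rs sF C1 eC es; have /setIdP[h _] := W1 s s0 rs sF.
  exact: (points_eq M C1 h eC (subsetP (sub_mclosure corank (wedges s)) e es)).
have -> : points corank F = mclosure corank (wedges p)
    |: [set mclosure corank (wedges q); mclosure corank (wedges r)].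
  apply/setP => C; apply/idP/idP => [/setIdP[C1 sCF]|]; last first.
    by rewrite in_setU1 in_set2 => /or3P[] /eqP->; apply: W1.
  have [e eC] := set0Pn _ (flat_ne0 M C1).
  have := subsetP sCF e eC; rewrite -eF !in_setU -orbA !in_set1.
  by case/or3P => [ep|eq|er]; [rewrite (clE p C e) | rewrite (clE q C e)| rewrite (clE r C e)];
    rewrite ?eqxx ?orbT.
have [d1 d2 d3] := And3 (dist _ _ rp rpq) (dist _ _ rq rqr) (dist _ _ rr rrp).
by rewrite cardsU1 cards2 in_set2 negb_or d1 d2 eq_sym d3.
Qed.

(** Representative of the class reached after [i] steps, the start being step 0. *)
Definition wnth x p i := nth x (x :: map snd p) i.

Lemma walk_nth B x p y e0 i : walk src tgt B x p y -> i < size p ->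
  joins src tgt B (nth e0 (map fst p) i) (wnth x p i) (wnth x p i.+1).
Proof.
(* The default of [nth] has to stay fixed while the start [x] moves along the induction. *)
rewrite /wnth; move=> + lip; have [z0 zE] : exists z0, z0 = x by exists x.
have nthE s j : j <= size s -> nth x (x :: map snd s) j = nth z0 (x :: map snd s) j.
  by move=> js; apply: set_nth_default; rewrite /= size_map ltnS.
rewrite !nthE //; last exact: ltnW.
elim: p i x {nthE zE} lip => // -[e z] p IH [|i] x /= lip /andP[jx wp] //.
exact: IH.
Qed.

Lemma wnth_last B x p y : walk src tgt B x p y -> wnth x p (size p) ~[B] y.
Proof.
move=> w; have : walk src tgt B x (p ++ [::]) y by rewrite cats0.
move/walk_split => [_]; rewrite /wnth -(size_map snd) nth_last /=; exact.
Qed.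

(** The walks number classes and edges as [theta_ends] does; injectivity of both numberings follows
    from surjectivity by counting. *)
Lemma theta_walks_class F u v p1 p2 p3 :
  F \in flats corank 2 -> tw F u v p1 p2 p3 -> ~~ (u ~[~: F] v) ->
  theta_class src tgt F.
Proof.
move=> F2 [w1 w2 w3 eF sF] nuv; set B := ~: F in w1 w2 w3 nuv.
have cB : (c B).+1 = #|F| := ncomp_line conn1 bless F2.
have pos p : walk src tgt B u p v -> 0 < size p.
  by case: p nuv => //= nuv; rewrite (negPf nuv).
have [k1_gt0 k2_gt0 k3_gt0] := And3 (pos p1 w1) (pos p2 w2) (pos p3 w3).
set k1 := size p1 in k1_gt0; set k2 := size p2 in k2_gt0; set k3 := size p3 in k3_gt0.
have kE : k1 + k2 + k3 = #|F| by rewrite -sF !size_cat addnA.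
(* The labels after 0 and 1 run through the inner vertices of the three paths in turn; the
   subtracted offsets recover positions on the walks. *)
pose f i := K B (if i == 0 then u else if i == 1 then v else
  if i <= k1 then wnth u p1 (i - 1) else
  if i < k1 + k2 then wnth u p2 (i - k1) else wnth u p3 (i - (k1 + k2 - 1))).
have f_in i : f i \in K B @: [set: V] by apply: comp_in.
have fpos base p : walk src tgt B u p v ->
    (forall i, 0 < i < size p -> f (base + i) = K B (wnth u p i)) ->
    forall i, i <= size p -> f (theta_pos base (size p) i) = K B (wnth u p i).
  move=> w h i; rewrite /theta_pos; have [->|i0] := eqVneq i 0; first by rewrite /f.
  have [->|ip] := eqVneq i (size p); last by move=> ?; rewrite h //; lia.
  by move=> _; rewrite /f /=; apply/eqP; rewrite comp_eq conn_sym wnth_last.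
have f1 i : i <= k1 -> f (theta_pos 1 k1 i) = K B (wnth u p1 i).
  apply: fpos w1 _ i => i; rewrite -/k1 => hi; rewrite /f.
  do 3?[case: ifP => ?; try by exfalso; lia]; congr (K B (wnth u _ _)); lia.
have f2 i : i <= k2 -> f (theta_pos k1 k2 i) = K B (wnth u p2 i).
  apply: fpos w2 _ i => i; rewrite -/k2 => hi; rewrite /f.
  do 4?[case: ifP => ?; try by exfalso; lia]; congr (K B (wnth u _ _)); lia.
have f3 i : i <= k3 -> f (theta_pos (k1 + k2 - 1) k3 i) = K B (wnth u p3 i).
  apply: fpos w3 _ i => i; rewrite -/k3 => hi; rewrite /f.
  do 4?[case: ifP => ?; try by exfalso; lia]; congr (K B (wnth u _ _)); lia.
have [e0 _] : exists e, e \in F by apply/set0Pn; rewrite -card_gt0; lia.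
pose g := nth e0 (map fst (p1 ++ p2 ++ p3)).
have fend i : i < k1 + k2 + k3 ->
  [/\ (theta_ends k1 k2 k3 i).1 < (k1 + k2 + k3).-1,
      (theta_ends k1 k2 k3 i).2 < (k1 + k2 + k3).-1 &
      [set f (theta_ends k1 k2 k3 i).1; f (theta_ends k1 k2 k3 i).2]
        = [set K B (src (g i)); K B (tgt (g i))]].
  have pos_lt base len j : 0 < base -> j <= len -> base + len < k1 + k2 + k3 ->
      theta_pos base len j < (k1 + k2 + k3).-1.
    move: k1_gt0 k2_gt0 k3_gt0; rewrite /theta_pos; clear => *.
    by do 2?case: ifP => ?; lia.
  have wE p j : walk src tgt B u p v -> j < size p ->
      [set K B (wnth u p j); K B (wnth u p j.+1)]
        = [set K B (src (nth e0 (map fst p) j)); K B (tgt (nth e0 (map fst p) j))].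
    by move=> w hj; apply/eqP; rewrite -joinsE; exact: (walk_nth e0 w hj).
  rewrite /theta_ends /g !map_cat !nth_cat !size_map -/k1 -/k2 => hi.
  case: ifP => i1.
    split; [apply: pos_lt; lia | apply: pos_lt; lia |].
    by rewrite /= !f1 //; [apply: wE | lia].
  have -> : (i < k1 + k2) = (i - k1 < k2) by lia.
  case: ifP => i2.
    split; [apply: pos_lt; lia | apply: pos_lt; lia |].
    by rewrite /= !f2 //; [apply: wE | lia].
  have i3 : i - (k1 + k2) < k3 by lia.
  split; [apply: pos_lt; lia | apply: pos_lt; lia |].
  rewrite /= subnDA in i3 *; rewrite !f3 //; [exact: wE | lia].
have size_g : size (map fst (p1 ++ p2 ++ p3)) = k1 + k2 + k3.
  by rewrite size_map !size_cat addnA.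
have g_in e : e \in F -> exists2 i, i < k1 + k2 + k3 & g i = e.
  by rewrite -eF inE => /(nthP e0)[i hi <-]; exists i; rewrite // -size_g.
(* Classes are reached from that of [u]: an edge of [F] has both end classes in the image of [f],
   any other edge stays in one class. *)
have f_surj x : exists2 i, i < (k1 + k2 + k3).-1 & K B x = f i.
  pose P y := exists2 i, i < (k1 + k2 + k3).-1 & K B y = f i.
  apply: (connect_stable (P := P) _ _ (connT conn1 u x)); first by exists 0; [lia|].
  move=> a b Pa /adjP[e _ h]; have [eF'|eF'] := boolP (e \in F).
    have [i ik gi] := g_in e eF'; have [l1 l2 /setP fE] := fend i ik.
    have : K B b \in [set K B (src (g i)); K B (tgt (g i))].
      by rewrite gi in_set2; case: h => -[h1 h2]; rewrite -?h1 -?h2 eqxx ?orbT.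
    rewrite -fE in_set2 => /orP[]/eqP hb.
      by exists (theta_ends k1 k2 k3 i).1.
    by exists (theta_ends k1 k2 k3 i).2.
  have [i ik ai] := Pa; exists i; rewrite // -ai; apply/eqP.
  rewrite comp_eq conn_sym; apply/connect1/adjP; exists e => //; by rewrite inE.
have imf : (fun i : 'I_(k1 + k2 + k3).-1 => f (val i)) @: [set: 'I_(k1 + k2 + k3).-1]
    = K B @: [set: V].
  apply/setP => X; apply/imsetP/imsetP => [[i _ ->]|[x _ ->]].
    by have /imsetP := f_in (val i).
  by have [i ik ->] := f_surj x; exists (Ordinal ik).
exists k1, k2, k3; split=> //; split.
- by rewrite kE -/B -cB.
- by move: F2; rewrite inE flat_bridgeless // => /andP[].
exists f, g; split=> //.
- move=> i j hi hj fij.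
  have /imset_injP inj : #|(fun i : 'I_(k1 + k2 + k3).-1 => f (val i)) @:
      [set: 'I_(k1 + k2 + k3).-1]| == #|[set: 'I_(k1 + k2 + k3).-1]|.
    by rewrite imf cardsT card_ord kE -cB.
  by have /(congr1 val) := inj (Ordinal hi) (Ordinal hj) (in_setT _) (in_setT _) fij.
- move=> i j hi hj /eqP; rewrite nth_uniq ?size_g // => [/eqP//|].
  by apply/card_uniqP; rewrite size_g kE -[in RHS]eF /wedges cardsE.
- apply/setP => e; apply/imsetP/idP => [[i _ ->]|/g_in[i hi <-]]; last by exists (Ordinal hi).
  by rewrite -eF inE mem_nth // size_g ltn_ord.
by move=> i hi; have [] := fend i hi.
Qed.
End ThetaWalks.

(** * Theta classes are lines with three points *)

Section ThetaClass.
Variables (V E : finType) (src tgt : E -> V).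
Hypothesis conn1 : ncomp src tgt [set: E] = 1.
Hypothesis bless : bridgeless src tgt [set: E].
Implicit Types (A B C D F : {set E}) (x y u v : V) (e : E) (p q r : seq (E * V)).

Local Notation "x ~[ A ] y" := (connect (adj src tgt A) x y)
  (at level 70, A at level 200, y at next level).
Local Notation c := (ncomp src tgt).
Local Notation corank := (corank src tgt).
Local Notation K := (Defs.comp src tgt).

Lemma theta_class_line F : theta_class src tgt F -> F \in flats corank 2.
Proof.
case=> k1 [k2 [k3 [k1_gt0 k2_gt0 k3_gt0 kE [cB bB _]]]].
rewrite inE flat_bridgeless // bB /=.
have := corankE conn1 bless F.
by rewrite cB kE; move: k1_gt0 k2_gt0 k3_gt0; clear => *; apply/eqP; lia.
Qed.

(** The isomorphism yields three walks; each visits distinct classes and so merges as many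
    components as [theta_walks_points] requires. *)
Lemma theta_class_points F : theta_class src tgt F -> #|points corank F| = 3.
Proof.
move=> tF; have F2 := theta_class_line tF; case: tF.
move=> k1 [k2 [k3 [k1_gt0 k2_gt0 k3_gt0 kE [cB bB [f [g [f_inj f_im g_inj g_im fg]]]]]]].
set B := ~: F in cB bB f_im fg *; set k := k1 + k2 + k3 in kE cB f_inj f_im g_inj g_im fg *.
have k_gt2 : 2 < k by move: k1_gt0 k2_gt0 k3_gt0; rewrite /k; clear; lia.
pose x0 := src (g 0).
(* The default [x0] is not taken below [k.-1], where [f i] is a component. *)
pose w i := odflt x0 [pick x | K B x == f i].
have wK i : i < k.-1 -> K B (w i) = f i.
  move=> ik; have : f i \in K B @: [set: V].
    by rewrite -f_im; apply/imsetP; exists (Ordinal ik).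
  case/imsetP => x _ fE; rewrite /w; case: pickP => [y /eqP//|/(_ x)].
  by rewrite fE eqxx.
(* [base] and [off] are the offsets of one path of the Theta in the numberings of vertices and
   edges. *)
pose path base off len s n := [seq (g (off + i), w (theta_pos base len i.+1)) | i <- iota s n].
have pathP base off len : 0 < base -> base + len < k -> 0 < len ->
    (forall i, i < len -> off + i < k /\ theta_ends k1 k2 k3 (off + i)
        = (theta_pos base len i, theta_pos base len i.+1)) ->
    walk src tgt B (w 0) (path base off len 0 len) (w 1) /\
    c (B :|: wedges (path base off len 0 len)) + len <= c B.
  move=> base0 blen len0 ends.
  have pos_lt j : j <= len -> theta_pos base len j < k.-1.
    move: base0 blen len0 k_gt2; rewrite /theta_pos; clear => *.
    by do 2?case: ifP => ?; lia.
  have W s n : s + n <= len ->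
      walk src tgt B (w (theta_pos base len s)) (path base off len s n)
        (w (theta_pos base len (s + n))).
    elim: n s => [|n IHn] s sn; first by rewrite addn0 /= connect0.
    have sl : s < len by move: sn; clear; lia.
    have := IHn s.+1; rewrite addSnnS => /(_ sn) IH.
    apply/andP; split; last exact: IH.
    rewrite joinsE.
    have [os oE] := ends s sl; have := fg _ os; rewrite oE /= => <-.
    by rewrite !wK ?pos_lt // ltnW.
  have pos1 : theta_pos base len len = 1.
    by rewrite /theta_pos eqxx; case: eqP => // l0; move: len0; rewrite l0.
  have := W 0 len; rewrite add0n leqnn pos1 => /(_ isT) w01; split=> //.
  (* The [len.+1] positions on the path lie in distinct classes, so [ncomp_merge] gives the drop by
     [len]. *)
  pose S := [set w (theta_pos base len (val i)) | i : 'I_len.+1].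
  have inj : injective (fun i : 'I_len.+1 => K B (w (theta_pos base len (val i)))).
    have lt_ord (i : 'I_len.+1) : theta_pos base len (val i) < k.-1.
      by apply: pos_lt; rewrite -ltnS ltn_ord.
    move=> i j; rewrite !wK ?lt_ord // => /f_inj.
    rewrite !lt_ord => /(_ isT isT) ij; apply/val_inj => /=.
    move: i j ij => [a al] [b bl] /=; move: al bl base0 len0; rewrite /theta_pos; clear.
    by do 4?case: ifP => ?; lia.
  have cS : #|S| = len.+1.
    rewrite card_imset ?card_ord // => i j ij; apply: inj => /=; by rewrite ij.
  have sBA : B \subset B :|: wedges (path base off len 0 len) by apply: subsetUl.
  have [_ vis] := walk_conn w01 sBA (subsetUr _ _).
  have := @ncomp_merge _ _ src tgt B (B :|: wedges (path base off len 0 len)) S (w 0) sBA.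
  rewrite cS addnS ltnS; apply.
    move=> _ /imsetP[[[|i] il] _ ->] /=; first by rewrite connect0.
    apply: vis; apply/mapP; exists (g (off + i), w (theta_pos base len i.+1)) => //.
    by apply/mapP; exists i; rewrite // mem_iota.
  by move=> _ _ /imsetP[i _ ->] /imsetP[j _ ->] /inj ->.
have [] := pathP 1 0 k1 isT _ k1_gt0.
- by move: k2_gt0 k3_gt0; rewrite /k; clear; lia.
- move=> i ik; rewrite /theta_ends add0n ik; split=> //.
  by move: ik; rewrite /k; clear; lia.
set p1 := path _ _ _ _ _ => w1 c1.
have [] := pathP k1 k1 k2 k1_gt0 _ k2_gt0.
- by move: k3_gt0; rewrite /k; clear; lia.
- move=> i ik; rewrite /theta_ends.
  have -> : (k1 + i < k1) = false by clear; lia.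
  by rewrite ltn_add2l ik addKn; split=> //; move: ik; rewrite /k; clear; lia.
set p2 := path _ _ _ _ _ => w2 c2.
have [] := pathP (k1 + k2 - 1) (k1 + k2) k3 _ _ k3_gt0.
- by move: k1_gt0 k2_gt0; clear; lia.
- by move: k1_gt0 k2_gt0; rewrite /k; clear; lia.
- move=> i ik; rewrite /theta_ends.
  have -> : (k1 + k2 + i < k1) = false by clear; lia.
  have -> : (k1 + k2 + i < k1 + k2) = false by clear; lia.
  by rewrite addKn; split=> //; move: ik; rewrite /k; clear; lia.
set p3 := path _ _ _ _ _ => w3 c3.
have sz b o l : size (path b o l 0 l) = l by rewrite size_map size_iota.
have tw : theta_walks src tgt F (w 0) (w 1) p1 p2 p3.
  split=> //; last by rewrite !size_cat !sz addnA kE.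
  apply/setP => e; rewrite -g_im inE !map_cat !mem_cat -!map_comp.
  apply/idP/imsetP => [|[[i ik] _ ->]] /=.
    case/or3P => /mapP[i]; rewrite mem_iota add0n /= => il ->.
    - have ik : 0 + i < k by move: il; rewrite /k; clear; lia.
      by exists (Ordinal ik); rewrite ?in_setT.
    - have ik : k1 + i < k by move: il; rewrite /k; clear; lia.
      by exists (Ordinal ik); rewrite ?in_setT.
    - have ik : k1 + k2 + i < k by move: il; rewrite /k; clear; lia.
      by exists (Ordinal ik); rewrite ?in_setT.
  have [i1|i1] := ltnP i k1.
    by apply/orP; left; apply/mapP; exists i; rewrite ?mem_iota.
  have [i2|i2] := ltnP i (k1 + k2).
    apply/or3P/Or32/mapP; exists (i - k1); rewrite /= ?subnKC //.
    by rewrite mem_iota; move: i1 i2; clear; lia.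
  apply/or3P/Or33/mapP; exists (i - (k1 + k2)); rewrite /= ?subnKC //.
  by rewrite mem_iota; move: i2 ik; rewrite /k; clear; lia.
have nil_size (s : seq (E * V)) : 0 < size s -> s != [::] by case: s.
by apply: theta_walks_points tw _ _ _ _ _ _; rewrite ?nil_size ?sz.
Qed.
End ThetaClass.

(** * Coefficients of the Tutte polynomial as sums over sets of small rank *)

Local Open Scope ring_scope.

(** The exponent [n + k] has the parity of $n-k$ and avoids truncated subtraction. *)
Lemma coef_XsubC1X (R : nzRingType) n k :
  (('X - 1 : {poly R}) ^+ n)`_k = (-1) ^+ (n + k) *+ 'C(n, k).
Proof.
elim: n k => [|n IHn] k; first by case: k => [|k]; rewrite coef1 //= bin0n mulr0n.
rewrite exprSr mulrBr mulr1 coefB coefMX; case: k => [|k].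
  by rewrite IHn !bin0 sub0r !addn0 exprS mulN1r.
by rewrite !IHn /= binS mulrnDr addrC addSn addnS !exprS !mulN1r opprK mulNrn opprK.
Qed.

Section Tutte.
Variables (V E : finType) (src tgt : E -> V).
Hypothesis conn1 : ncomp src tgt [set: E] = 1%N.
Hypothesis bless : bridgeless src tgt [set: E].
Implicit Types (A B C D F : {set E}).
Local Notation c := (ncomp src tgt).
Local Notation rk := (corank src tgt).

Let M : loopless_rank rk := corankM conn1 bless.

(** The rank $m-n+1$ of the dual matroid. *)
Definition nullity := (#|E|.+1 - #|V|)%N.

Lemma ncomp_set0 : c set0 = #|V|.
Proof.
rewrite /ncomp card_imset ?cardsT // => x y /eqP; rewrite comp_eq.
by case/connectP=> [[|z p]] //= /andP[/adjP[e]]; rewrite inE.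
Qed.

(** These bounds make the truncated subtractions in [rho], [gamma] and [nullity] exact. *)
Lemma card_ncomp B : (#|V| <= #|~: B| + c (~: B))%N /\ (0 < c (~: B) <= #|V|)%N.
Proof.
have := ncomp_drop src tgt set0 (~: B); rewrite set0U ncomp_set0.
have := ncomp_drop src tgt (~: B) B; rewrite setUC setUCr conn1.
by clear; lia.
Qed.

Lemma rank_nullity B : (rk B <= nullity)%N /\ nullity%:Z = #|E|%:Z - #|V|%:Z + 1.
Proof.
have [] := card_ncomp B; have := corankE conn1 bless B; have := cardsC B.
rewrite -cardsT /nullity cardsT; clear; lia.
Qed.

(** Coefficient of $x^k$ in $(x-1)^n$. *)
Definition w k n : int := (-1) ^+ (n + k) *+ 'C(n, k).

Lemma coef_tutte a b : ((tutte src tgt)`_a)`_b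
  = \sum_(B : {set E}) w a (#|B| - rk B) * w b (nullity - rk B).
Proof.
rewrite /tutte (reindex_inj (inv_inj (@setCK E))) !coef_sum; apply: eq_bigr => B _.
rewrite coefMC coef_XsubC1X.
have -> : (-1) ^+ (rho src tgt [set: E] - rho src tgt (~: B) + a)
    *+ 'C(rho src tgt [set: E] - rho src tgt (~: B), a) = (w a (#|B| - rk B))%:P :> {poly int}.
  have -> : (rho src tgt [set: E] - rho src tgt (~: B) = #|B| - rk B)%N.
    rewrite /rho conn1; have [_] := card_ncomp B.
    by have := corankE conn1 bless B; clear; lia.
  by rewrite /w -polyC1 -polyCN -polyC_exp -polyCMn.
have -> : gamma src tgt (~: B) = (nullity - rk B)%N.
  rewrite /gamma /nullity; have [] := card_ncomp B.
  have := corankE conn1 bless B; have := cardsC B; clear; lia.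
by rewrite coefCM coef_XsubC1X.
Qed.

Definition wsum a k := \sum_(B : {set E} | rk B == k) w a (#|B| - rk B).

Lemma wsum_gt a k : (nullity < k)%N -> wsum a k = 0.
Proof.
move=> rk_lt; rewrite /wsum big_pred0 // => B; apply/negP => /eqP rB.
by have [] := rank_nullity B; rewrite rB leqNgt rk_lt.
Qed.

(** The factor coming from $y$ depends only on the rank; near the top degree it vanishes beyond rank
    2. *)
Lemma sum_by_rank a (h : nat -> int) (y0 y1 y2 : int) :
  (forall k, (k <= nullity)%N ->
     h k = y0 * (k == 0)%N%:Z + y1 * (k == 1)%N%:Z + y2 * (k == 2)%N%:Z) ->
  \sum_(B : {set E}) w a (#|B| - rk B) * h (rk B)
    = y0 * wsum a 0 + y1 * wsum a 1 + y2 * wsum a 2.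
Proof.
move=> hE; rewrite /wsum !mulr_sumr.
rewrite [X in _ = X + _ + _]big_mkcond [X in _ = _ + X + _]big_mkcond [X in _ = _ + X]big_mkcond.
rewrite -!big_split; apply: eq_bigr => B _ /=.
have [rB _] := rank_nullity B; rewrite hE //.
by case: (rk B) => [|[|[|k]]] /=; rewrite ?mulr0 ?mulr1 ?addr0 ?add0r // mulrC.
Qed.

Lemma w_small k n : (n < k)%N -> w k n = 0.
Proof. by move=> nk; rewrite /w bin_small. Qed.

Lemma w_diag n : w n n = 1.
Proof. by rewrite /w binn addnn -mul2n exprM sqrrN !expr1n. Qed.

Lemma w_subdiag n : w n n.+1 = - n.+1%:Z.
Proof.
rewrite /w addSn addnn -mul2n exprS exprM sqrrN !expr1n mulr1.
by rewrite -bin_sub // subSnn bin1 mulNrn natz.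
Qed.

Lemma w_subsubdiag n : w n n.+2 = 'C(n.+2, 2)%:Z.
Proof.
rewrite /w !addSn addnn -mul2n !exprS exprM sqrrN !expr1n mulr1 mulrNN mulr1.
rewrite -bin_sub; last exact: leqW (leqnSn n).
have -> : (n.+2 - n = 2)%N by lia.
exact: natz.
Qed.

Lemma tcoef_top (a : nat) : tcoef src tgt a (nullity : int) = wsum a 0.
Proof.
rewrite /= coef_tutte (@sum_by_rank a (fun k => w nullity (nullity - k)) 1 0 0).
  by rewrite mul1r !mul0r !addr0.
move=> [|k] kr; first by rewrite subn0 w_diag.
by rewrite w_small ?mul0r ?mulr0 ?addr0 //; move: kr; clear; lia.
Qed.

Lemma tcoef_top1 (a : nat) : tcoef src tgt a (nullity%:Z - 1)
  = - nullity%:Z * wsum a 0 + wsum a 1.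
Proof.
(* For [nullity] 0 the exponent of $y$ is negative, where [tcoef] is 0, and no set has rank 1. *)
case rE : nullity => [|r]; first by rewrite /= (@wsum_gt a 1) ?rE // oppr0 mul0r addr0.
have -> : r.+1%:Z - 1 = r by lia.
rewrite /= coef_tutte (@sum_by_rank a (fun k => w r (nullity - k)) (- r.+1%:Z) 1 0).
  by rewrite mul1r mul0r addr0.
rewrite rE => -[|[|k]] kr; first by rewrite subn0 w_subdiag; lia.
  by rewrite subSS subn0 w_diag; lia.
by rewrite w_small; move: kr; clear; lia.
Qed.

Lemma tcoef_top2 (a : nat) : tcoef src tgt a (nullity%:Z - 2)
  = 'C(nullity, 2)%:Z * wsum a 0 - (nullity%:Z - 1) * wsum a 1 + wsum a 2.
Proof.
(* For [nullity] 0 or 1 the exponent is negative; on the right each term has a zero factor or no set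
   of its rank. *)
case rE : nullity => [|[|r]].
- by rewrite /= (@wsum_gt a 1) ?(@wsum_gt a 2) ?rE // mulr0 mul0r subr0 addr0.
- by rewrite /= (@wsum_gt a 2) ?rE // subrr !mul0r subr0 addr0.
have -> : r.+2%:Z - 2 = r by lia.
rewrite /= coef_tutte
  (@sum_by_rank a (fun k => w r (nullity - k)) 'C(r.+2, 2) (- r.+1%:Z) 1).
  have -> : r.+2%:Z - 1 = r.+1%:Z by lia.
  by rewrite mul1r mulNr.
rewrite rE => -[|[|[|k]]] kr; first by rewrite subn0 w_subsubdiag; lia.
- by rewrite subSS subn0 w_subdiag; lia.
- by rewrite !subSS subn0 w_diag; lia.
by rewrite w_small; move: kr; clear; lia.
Qed.

Lemma w0E n : w 0 n = (-1) ^+ n.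
Proof. by rewrite /w addn0 bin0. Qed.

Lemma w1E n : w 1 n = - (-1) ^+ n * n%:Z.
Proof. by rewrite /w addn1 bin1 exprS mulN1r -mulr_natr natz. Qed.

Lemma wsum_flats a k :
  wsum a k = \sum_(F in flats rk k)
     \sum_(B : {set E} | (B \subset F) && (rk B == k)) w a (#|B| - rk B).
Proof.
have fT : flat rk [set: E] by apply: subsetT.
rewrite /wsum (eq_bigl (fun B => (B \subset [set: E]) && (rk B == k))).
  by rewrite (sum_flat M) //; apply: eq_bigl => F; rewrite subsetT andbT.
by move=> B; rewrite subsetT.
Qed.

Lemma wsum_rank0 a : wsum a 0 = (a == 0)%N%:Z.
Proof.
rewrite /wsum sum_rk0 // cards0; case: a => [|a]; last by rewrite w_small.
by rewrite w_diag.
Qed.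

Lemma wsum01 : wsum 0 1 = #|flats rk 1|%:Z.
Proof.
rewrite wsum_flats (eq_bigr (fun _ => 1)) ?sumr_const ?natz // => C C1.
by under eq_bigr do rewrite w0E; apply: sum_sign_point.
Qed.

Lemma wsum11 : wsum 1 1 = #|[set C in flats rk 1 | (1 < #|C|)%N]|%:Z.
Proof.
rewrite wsum_flats (eq_bigr (fun C : {set E} => (1 < #|C|)%N%:Z)) => [|C C1].
  rewrite -sum1_card -natz natr_sum [RHS](eq_bigl (fun C => (C \in flats rk 1) && (1 < #|C|)%N)).
    by rewrite big_mkcondr; apply: eq_bigr => C _; case: ltnP.
  by move=> C; rewrite [LHS]inE.
by under eq_bigr do rewrite w1E; apply: sum_deriv_point.
Qed.

Lemma wsum02 : wsum 0 2 = \sum_(F in flats rk 2) (#|points rk F|%:Z - 1).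
Proof.
rewrite wsum_flats; apply: eq_bigr => F F2.
by under eq_bigr do rewrite w0E; apply: sum_sign_line.
Qed.

Lemma wsum12 : wsum 1 2 =
  \sum_(F in flats rk 2) (#|points rk F|%:Z - 2 + #|nontrivial rk F|%:Z).
Proof.
rewrite wsum_flats; apply: eq_bigr => F F2.
by under eq_bigr do rewrite w1E; apply: sum_deriv_line.
Qed.

Lemma series_classesE : series_classes src tgt [set: E] = flats rk 1.
Proof. by apply/setP => C; rewrite inE series_classE. Qed.

(** The sums over lines and over their non-trivial points are exchanged; [s_num_setC] counts the
    lines through each point. *)
Lemma sum_nontrivial :
  (\sum_(F in flats rk 2) #|nontrivial rk F|
    = \sum_(A in series_classes src tgt [set: E] | 1 < #|A|) s_num src tgt (~: A))%N.
Proof.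
under eq_bigr do rewrite -sum1_card.
rewrite (exchange_big_dep (fun A => (A \in flats rk 1) && (1 < #|A|)%N)) /=; last first.
  by move=> F A _; rewrite !inE => /andP[/andP[-> _] ->].
rewrite series_classesE; apply: eq_bigr => A /andP[A1 A2].
rewrite s_num_setC // -sum1_card; apply: eq_bigl => F.
rewrite [RHS]in_set; apply: andb_id2l => _.
by rewrite in_set A2 andbT in_set A1.
Qed.

(** * Counting lines and Theta classes *)

Variable Th : {set {set E}}.
Hypothesis ThP : forall C, C \in Th <-> theta_class src tgt C.

(** A third point turns a line into a Theta class, which has exactly three points. *)
Lemma card_points F : F \in flats rk 2 -> #|points rk F| = (2 + (F \in Th))%N.
Proof.
move=> F2; have [/ThP tF|nF] := boolP (F \in Th); first exact: theta_class_points.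
apply/eqP; rewrite addn0 eqn_leq (line_points_ge2 M) // andbT leqNgt.
apply: contra nF => p3; apply/ThP.
have [u [v [p1 [p2 [p3' [tw nuv]]]]]] := line3_theta_walks conn1 bless F2 p3.
exact: theta_walks_class tw nuv.
Qed.

Lemma card_theta : #|Th| = (\sum_(F in flats rk 2) (F \in Th))%N.
Proof.
rewrite -sum1_card big_mkcond [RHS]big_mkcond; apply: eq_bigr => F _.
case: (boolP (F \in Th)) => [/ThP/(theta_class_line conn1 bless)->//|_]; by case: ifP.
Qed.

(** A line carries 2 ordered pairs of distinct points, or 6 if it is a Theta class. *)
Lemma bin2_points : 'C(#|flats rk 1|, 2) = (#|flats rk 2| + 2 * #|Th|)%N.
Proof.
have h : (#|flats rk 1| * #|flats rk 1|.-1 = (#|flats rk 2| + 2 * #|Th|).*2)%N.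
  rewrite (sum_points_lines M) card_theta -sum1_card big_distrr -big_split /= -muln2.
  rewrite big_distrl; apply: eq_bigr => F F2; rewrite card_points //.
  by case: (F \in Th).
by rewrite bin2 h doubleK.
Qed.

(** Each line contributes 1, or 2 if it is a Theta class; [bin2_points] then eliminates the number
    of lines. *)
Lemma wsum02_theta : wsum 0 2 = 'C(#|flats rk 1|, 2)%:Z - #|Th|%:Z.
Proof.
have -> : wsum 0 2 = #|flats rk 2|%:Z + #|Th|%:Z.
  rewrite wsum02 card_theta -sum1_card -!natz !natr_sum -big_split.
  by apply: eq_bigr => F F2; rewrite card_points //; case: (F \in Th).
rewrite bin2_points PoszD PoszM; ring.
Qed.

Lemma wsum12_theta : wsum 1 2 =
  \sum_(A in series_classes src tgt [set: E] | (1 < #|A|)%N) (s_num src tgt (~: A))%:Z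
  + #|Th|%:Z.
Proof.
transitivity ((\sum_(F in flats rk 2) #|nontrivial rk F|)%N%:Z + #|Th|%:Z).
  rewrite wsum12 card_theta -!natz !natr_sum -big_split.
  apply: eq_bigr => F F2; rewrite card_points // natz.
  by case: (F \in Th) => /=; lia.
by rewrite sum_nontrivial -natz natr_sum; under eq_bigr do rewrite natz.
Qed.
End Tutte.

(** * The five coefficients *)

Theorem theorem1 (V E : finType) (src tgt : E -> V)
    (loopless : forall e, src e != tgt e)
    (connected : ncomp src tgt [set: E] = 1%N)
    (bridgeless_G : bridgeless src tgt [set: E])
    (ThetaClasses : {set {set E}})
    (hTheta : forall C, C \in ThetaClasses <-> theta_class src tgt C) :
  let n : int := #|V|%:Z in
  let m : int := #|E|%:Z in
  let s : int := (s_num src tgt [set: E])%:Z in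
  let sstar : int := (s_star src tgt [set: E])%:Z in
  let th : int := #|ThetaClasses|%:Z in
  [/\ tcoef src tgt 0 (m - n + 1) = 1,
      tcoef src tgt 0 (m - n) = n + s - m - 1,
      tcoef src tgt 0 (m - n - 1)
        = ('C(#|E|.+1 - #|V|, 2))%:Z - (m - n) * s
          + ('C(s_num src tgt [set: E], 2))%:Z - th,
      tcoef src tgt 1 (m - n) = sstar &
      tcoef src tgt 1 (m - n - 1)
        = - sstar * (m - n)
          + \sum_(A in series_classes src tgt [set: E] | (1 < #|A|)%N)
              (s_num src tgt (~: A))%:Z
          + th].
Proof.
move=> n m s sstar th.
have [_ rE] := rank_nullity connected bridgeless_G set0.
have e0 : m - n + 1 = nullity V E by rewrite rE.
have e1 : m - n = (nullity V E)%:Z - 1 by rewrite -e0 addrK.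
have e2 : m - n - 1 = (nullity V E)%:Z - 2 by rewrite e1; lia.
(* Series classes are the points, so both counts are sums over sets of rank 1. *)
have sE : s = wsum src tgt 0 1 by rewrite wsum01 // /s /s_num series_classesE.
have sstarE : sstar = wsum src tgt 1 1.
  by rewrite wsum11 // /sstar /s_star series_classesE.
rewrite e2 e0 e1 -/(nullity V E) sE sstarE.
rewrite [tcoef _ _ 0 _](tcoef_top connected bridgeless_G 0).
rewrite !(tcoef_top1 connected bridgeless_G) !(tcoef_top2 connected bridgeless_G).
rewrite !wsum_rank0 // (wsum02_theta connected bridgeless_G hTheta).
rewrite (wsum12_theta connected bridgeless_G hTheta) -/th.
have -> : s_num src tgt [set: E] = #|flats (corank src tgt) 1|.
  by rewrite /s_num series_classesE.
split=> //.
- by rewrite mulr1 -sE; move: rE; rewrite -/n -/m => ->; ring.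
- by rewrite mulr1; ring.
- by rewrite mulr0 add0r.
by rewrite mulr0; ring.
Qed.
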